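(* Let $\sigma$ be a type in the variables $V_1,\ldots,V_k$ and let $X_1,\ldots,X_k$ be nonempty complete, separable metric spaces. Then $\sigma(X_1,\ldots,X_k)$ is homeomorphic to a functionally closed subset of $\sigma(U,\ldots,U)$, where $U$ is the Urysohn space.
   Context: Types: $V_1,\ldots,V_k$ are formal variables; the types are the least set of expressions containing each $V_i$ and closed under forming $(\sigma\rightarrow\tau)$ from types $\sigma,\tau$. Given spaces $X_1,\ldots,X_k$, the interpretation $\sigma(X_1,\ldots,X_k)$ is defined by $V_i(\vec X)=X_i$ (with its metric topology) and $(\sigma\rightarrow\tau)(\vec X)=$ the set of continuous maps $\sigma(\vec X)\to\tau(\vec X)$, equipped with the sequential topology determined by the convergence: $f=\lim_n f_n$ iff for every convergent sequence $x=\lim_n x_n$ in the domain, $f(x)=\lim_n f_n(x_n)$ (i.e. the finest topology in which exactly these sequences converge; this is the exponential in the category of $qcb$-spaces). The Urysohn space $U$ is the unique (up to isometry) complete separable metric space that is finitely saturated: whenever $K\subseteq L$ are finite metric spaces and $\phi:K\to U$ is distance-preserving, $\phi$ extends to a distance-preserving map $L\to U$. A subset $A$ of a space $Z$ is functionally closed if there is a continuous $f:Z\to[0,1]$ with $A=f^{-1}(\{0\})$. *)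

(* Defs.v *)
From HB Require Import structures.
From mathcomp Require Import all_boot all_order all_algebra.
From mathcomp Require Import all_classical all_reals all_analysis.

Set Implicit Arguments.
Unset Strict Implicit.
Unset Printing Implicit Defensive.

Import Order.TTheory GRing.Theory Num.Theory.
Import numFieldNormedType.Exports.

Local Open Scope classical_set_scope.
Local Open Scope ring_scope.

(* [Complete] extends [Pointed]: a [completeMetricType] is a nonempty complete
   metric space. *)
#[short(type="completeMetricType")]
HB.structure Definition CompleteMetric (K : numDomainType) :=
  { T of Metric K T & Complete T }.

Definition separable (T : topologicalType) : Prop :=
  exists2 D : set T, countable D & dense D.

(* [K] carries the metric induced by [L]. *)
Definition finitely_saturated (R : realType) (U : metricType R) : Prop :=
  forall (L : metricType R) (K : set L) (phi : K -> U),
    finite_set [set: L] ->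
    (forall x y : K, mdist (phi x) (phi y) = mdist (set_val x) (set_val y)) ->
    exists psi : L -> U,
      (forall x y : L, mdist (psi x) (psi y) = mdist x y) /\
      (forall x : K, psi (set_val x) = phi x).

Definition is_urysohn (R : realType) (U : completeMetricType R) : Prop :=
  separable U /\ finitely_saturated U.

(* A synonym of [continuousType X Y], so that the topology below does not clash
   with the other topologies that the library has for [continuousType X Y]. *)
Definition seq_fun (X Y : topologicalType) : Type := continuousType X Y.

HB.instance Definition _ (X Y : topologicalType) :=
  Choice.copy (seq_fun X Y) (continuousType X Y).

Definition seq_fun_app (X Y : topologicalType) (f : seq_fun X Y) : X -> Y :=
  (f : continuousType X Y).

Coercion seq_fun_app : seq_fun >-> Funclass.

Definition seq_fun_cvg (X Y : topologicalType) (f_ : nat -> seq_fun X Y)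
    (f : seq_fun X Y) : Prop :=
  forall (x_ : nat -> X) (x : X),
    x_ n @[n --> \oo] --> x -> f_ n (x_ n) @[n --> \oo] --> f x.

(* The open sets of the finest topology in which [seq_fun_cvg f_ f] implies
   that [f_] converges to [f]. *)
Definition seq_fun_open (X Y : topologicalType) : set_system (seq_fun X Y) :=
  [set A | forall f_ f, seq_fun_cvg f_ f -> A f -> \forall n \near \oo, A (f_ n)].

Lemma seq_fun_openT (X Y : topologicalType) : @seq_fun_open X Y setT.
Proof. by move=> f_ f _ _; exact: nearW. Qed.

Lemma seq_fun_openI (X Y : topologicalType) : setI_closed (@seq_fun_open X Y).
Proof.
by move=> A B oA oB f_ f ff [Af Bf]; apply: filterI; [exact: oA Af|exact: oB Bf].
Qed.

Lemma seq_fun_open_bigU (X Y : topologicalType) (I : Type)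
    (A : I -> set (seq_fun X Y)) :
  (forall i, seq_fun_open (A i)) -> seq_fun_open (\bigcup_i A i).
Proof.
move=> oA f_ f ff [i _ Aif].
by apply: filterS (oA i f_ f ff Aif) => n Afn; exists i.
Qed.

HB.instance Definition _ (X Y : topologicalType) :=
  isOpenTopological.Build (seq_fun X Y)
    (@seq_fun_openT X Y) (@seq_fun_openI X Y) (@seq_fun_open_bigU X Y).

Inductive ty (k : nat) : Type :=
| Var of 'I_k
| Arrow of ty k & ty k.

Fixpoint interp (k : nat) (X : 'I_k -> topologicalType) (s : ty k) :
    topologicalType :=
  match s with
  | Var i => X i
  | Arrow s t => seq_fun (interp X s) (interp X t)
  end.

Definition functionally_closed (R : realType) (Z : topologicalType)
    (A : set Z) : Prop :=
  exists f : Z -> R,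
    [/\ continuous f, forall z, 0 <= f z <= 1 & A = f @^-1` [set 0]].

Definition homeomorphic (X Y : topologicalType) : Prop :=
  exists (f : X -> Y) (g : Y -> X),
    [/\ continuous f, continuous g, cancel f g & cancel g f].

(* Main.v *)
(* Averages of points of X, i.e. finitely supported probability measures on
   X with the bounded Lipschitz metric, form a separable pseudometric space,
   which maps isometrically into U by saturation. By induction on the type
   s, with Z = s(X) and W = s(U), we carry an averaging map from finitely
   supported measures on Z to W, whose restriction to Dirac masses is the
   embedding Z -> W, together with a countable family of closed conditions
   on W (iterated "p implies q" over balls) such that those conditions which
   eventually hold along a sequence converging to the image of z already
   force convergence to z in Z.

   The conditions yield a continuous "probabilistic retraction" of W onto
   measures on Z: at w, run through the first conditions (about 1/d many,
   where d measures the distance of w to Z), keep at random those almost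
   satisfied by w, greedily subject to being jointly satisfiable in Z, and
   return a point of Z satisfying all those kept. As w tends to the image of
   z, every condition that eventually holds is kept, so the law tends to the
   Dirac mass at z. A map f : s(X) -> t(X) is then extended to s(U) -> t(U)
   by averaging f over the law attached to a point of s(U). The image is
   functionally closed because w lies in it iff w maps s(X) into the image
   of t(X) and coincides with the extension of its restriction, which can be
   tested on countable dense sets. *)

Require Import Defs.
From HB Require Import structures.
From mathcomp Require Import all_boot all_order all_algebra.
From mathcomp Require Import all_classical all_reals all_analysis.
From mathcomp Require Import ring lra.

Set Implicit Arguments.
Unset Strict Implicit.
Unset Printing Implicit Defensive.

Import Order.TTheory GRing.Theory Num.Theory.
Import numFieldNormedType.Exports.

Local Open Scope classical_set_scope.
Local Open Scope ring_scope.

(** * Sequential convergence in function spaces *)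

Lemma near_forall_ltn (P : nat -> nat -> Prop) (m : nat) :
  (forall n, (n < m)%N -> \forall k \near \oo, P n k) ->
  \forall k \near \oo, forall n, (n < m)%N -> P n k.
Proof.
elim: m => [|m IH] Pm; first by apply: nearW.
have Pm' : \forall k \near \oo, forall n, (n < m)%N -> P n k.
  by apply: IH => n nm; apply: Pm; exact: ltnW.
apply: filterS2 Pm' (Pm m (ltnSn m)) => k Pk Pmk n.
by rewrite ltnS leq_eqVlt => /predU1P[->|/Pk].
Qed.

(** Function spaces are known through their convergent sequences only; continuity is checked along
    sequences, and this property makes it topological. *)
Definition sequential (T : topologicalType) : Prop :=
  forall A : set T,
    (forall (x_ : nat -> T) x, x_ @ \oo --> x -> A x ->
       \forall n \near \oo, A (x_ n)) -> open A.

Definition seq_continuous (T V : topologicalType) (f : T -> V) : Prop :=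
  forall (x_ : nat -> T) x, x_ @ \oo --> x -> f \o x_ @ \oo --> f x.

Lemma seq_continuous_continuous (T V : topologicalType) (f : T -> V) :
  sequential T -> seq_continuous f -> continuous f.
Proof.
move=> sT cf; apply/continuousP => A oA; apply: sT => x_ x xx Afx.
exact: (cf _ _ xx A (open_nbhs_nbhs (conj oA Afx))).
Qed.

Lemma continuous_seq_continuous (T V : topologicalType) (f : T -> V) :
  continuous f -> seq_continuous f.
Proof. by move=> cf x_ x xx; exact: cvg_comp xx (cf x). Qed.

Section seq_fun_theory.
Variables X Y : topologicalType.
Implicit Types f g : seq_fun X Y.

Lemma seq_fun_continuous f : continuous f.
Proof. exact: (@cts_fun _ _ (f : continuousType X Y)). Qed.

Lemma seq_funP f g : f =1 g -> f = g.
Proof. by move=> fg; apply/continuousEP. Qed.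

Lemma seq_fun_openE (A : set (seq_fun X Y)) : open A = seq_fun_open A.
Proof. by []. Qed.

(* Only finitely many points of the compact set [x_ n -> x] can witness that
   infinitely many terms of a convergent sequence of maps leave this set, so the
   functions that map a tail of [x_] and its limit into [V] form an open set. *)
Lemma seq_fun_open_tail (x_ : nat -> X) (x : X) (V : set Y) (N : nat) :
  x_ @ \oo --> x -> open V ->
  open [set g : seq_fun X Y | V (g x) /\ forall n, (N <= n)%N -> V (g (x_ n))].
Proof.
move=> xx oV; rewrite seq_fun_openE => g_ g gg [Vgx Vg].
have nV y : V y -> nbhs y V by move=> Vy; apply: open_nbhs_nbhs.
have fin n : (N <= n)%N -> \forall k \near \oo, V (g_ k (x_ n)).
  by move=> /Vg /nV; exact: (gg (fun=> x_ n) (x_ n) (cvg_cst _)).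
pose bad k n := (N <= n)%N /\ ~ V (g_ k (x_ n)).
(* The default value [k] keeps [x_ \o y_] convergent to [x] when stage [k] has no bad index. *)
have /choice[y_ y_P] : forall k, exists m, bad k m \/ m = k /\ forall n, ~ bad k n.
  move=> k; have [[n bn]|nb] := pselect (exists n, bad k n).
    by exists n; left.
  by exists k; right; split=> // n bn; apply: nb; exists n.
have yx : (fun k => x_ (y_ k)) @ \oo --> x.
  apply: (cvg_comp y_ x_ _ xx) => A [M _ MA].
  have HM : \forall k \near \oo, forall n, (n < M)%N -> (N <= n)%N -> V (g_ k (x_ n)).
    apply: near_forall_ltn => n _; have [/fin|] := leqP N n; first exact: filterS.
    by move=> _; apply: nearW.
  suff : \forall k \near \oo, (M <= y_ k)%N by apply: filterS => k; exact: MA.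
  apply: filterS2 HM (nbhs_infty_ge M) => k Hk Mk.
  have [[Ny nVy]|[-> _]//] := y_P k.
  by rewrite leqNgt; apply/negP => yM; apply: nVy; exact: Hk.
have Vy : \forall k \near \oo, V (g_ k (x_ (y_ k))) :=
  gg _ _ yx V (nV _ Vgx).
have Vx : \forall k \near \oo, V (g_ k x).
  by apply: (gg (fun=> x) x _ V (nV _ Vgx)); exact: cvg_cst.
apply: filterS2 Vy Vx => k /= Vky Vkx; split=> // n Nn.
have [[_ /(_ Vky)//]|[_ nb]] := y_P k.
by apply: contrapT => nV'; apply: (nb n).
Qed.

(** The finest topology gains no convergent sequences: for [V] open around [f x], the maps sending
    [x] and a tail of [x_] into [V] form an open set around [f], which [f_] must enter. *)
Lemma seq_fun_cvgP (f_ : nat -> seq_fun X Y) f :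
  f_ @ \oo --> f <-> seq_fun_cvg f_ f.
Proof.
split=> [ff x_ x xx A|ff A].
  rewrite nbhsE => -[V [oV Vfx] VA].
  have [N _ NV] : \forall n \near \oo, V (f (x_ n)).
    apply: (continuous_seq_continuous (@seq_fun_continuous f) xx).
    exact: open_nbhs_nbhs.
  have fV : \forall n \near \oo, V (f_ n x) /\
      forall k, (N <= k)%N -> V (f_ n (x_ k)).
    apply: (ff [set g : seq_fun X Y | V (g x) /\
      forall k, (N <= k)%N -> V (g (x_ k))]).
    apply: open_nbhs_nbhs; split; last by split.
    exact: seq_fun_open_tail xx oV.
  apply: filterS2 fV (nbhs_infty_ge N) => n [_ Vn] Nn.
  exact: VA (Vn n Nn).
by rewrite nbhsE => -[V [oV Vf] VA]; apply: filterS (oV _ _ ff Vf) => n; exact: VA.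
Qed.

Lemma seq_fun_sequential : sequential (seq_fun X Y).
Proof.
by move=> A sA; rewrite seq_fun_openE => f_ f /seq_fun_cvgP; exact: sA.
Qed.

Lemma seq_fun_of (f : X -> Y) : sequential X -> seq_continuous f ->
  exists g : seq_fun X Y, g =1 f.
Proof.
move=> sX cf.
pose c := isContinuous.Build X Y f (seq_continuous_continuous sX cf).
pose g : continuousType X Y := HB.pack f c.
by exists (g : seq_fun X Y).
Qed.

End seq_fun_theory.

(** * Finitely supported measures *)

Section weighted_lists.
Context {R : realType}.

(** Integral against a signed measure: lists may repeat points and carry negative weights; [mprob]
    singles out the probability measures. *)
Definition ev (Z : Type) (mu : seq (R * Z)) (phi : Z -> R) : R :=
  \sum_(p <- mu) p.1 * phi p.2.

Definition mdirac (Z : Type) (z : Z) : seq (R * Z) := [:: (1, z)].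

Definition mmap (Z V : Type) (f : Z -> V) (mu : seq (R * Z)) : seq (R * V) :=
  [seq (p.1, f p.2) | p <- mu].

Definition mbind (Z V : Type) (mu : seq (R * Z)) (K : Z -> seq (R * V)) :
    seq (R * V) :=
  flatten [seq [seq (p.1 * q.1, q.2) | q <- K p.2] | p <- mu].

Lemma ev_dirac (Z : Type) (z : Z) phi : ev (mdirac z) phi = phi z.
Proof. by rewrite /ev big_seq1 mul1r. Qed.

Lemma ev_map (Z V : Type) (f : Z -> V) mu phi :
  ev (mmap f mu) phi = ev mu (phi \o f).
Proof. by rewrite /ev big_map. Qed.

Lemma ev_bind (Z V : Type) (mu : seq (R * Z)) (K : Z -> seq (R * V)) phi :
  ev (mbind mu K) phi = ev mu (fun z => ev (K z) phi).
Proof.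
rewrite /ev big_flatten big_map; apply: eq_bigr => p _.
by rewrite big_map mulr_sumr; apply: eq_bigr => q _; rewrite mulrA.
Qed.

Lemma eq_ev (Z : Type) (mu : seq (R * Z)) phi psi :
  phi =1 psi -> ev mu phi = ev mu psi.
Proof. by move=> e; apply: eq_bigr => p _; rewrite e. Qed.

Lemma evB (Z : Type) (mu : seq (R * Z)) phi psi :
  ev mu (fun z => phi z - psi z) = ev mu phi - ev mu psi.
Proof. by rewrite /ev -sumrB; apply: eq_bigr => p _; rewrite mulrBr. Qed.

Lemma ev_cvg0 (Z : Type) (mu : seq (R * Z)) (phi : nat -> Z -> R) :
  (forall z, phi ^~ z @ \oo --> (0 : R)) ->
  (fun k => ev mu (phi k)) @ \oo --> (0 : R).
Proof.
move=> phi0; rewrite /ev; elim: mu => [|p mu IH].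
  rewrite (_ : (fun _ => _) = fun=> 0); first exact: cvg_cst.
  by apply/funext => k; rewrite big_nil.
rewrite (_ : (fun _ => _) =
    fun k => p.1 * phi k p.2 + \sum_(p <- mu) p.1 * phi k p.2); last first.
  by apply/funext => k; rewrite big_cons.
have p0 : (fun k => p.1 * phi k p.2) @ \oo --> (0 : R).
  by rewrite -(mulr0 p.1); apply: cvgM; [exact: cvg_cst|exact: phi0].
by have := cvgD p0 IH; rewrite [0 + 0]addr0; exact.
Qed.

Lemma cvg0_le (u v : nat -> R) :
  (\forall k \near \oo, `|u k| <= v k) -> v @ \oo --> (0 : R) ->
  u @ \oo --> (0 : R).
Proof.
move=> uv v0; apply/norm_cvg0P; apply: (@squeeze_cvgr _ _ _ _ (fun=> 0) v) => //.
  by apply: filterS uv => k ->; rewrite normr_ge0.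
exact: cvg_cst.
Qed.

Lemma cvg0_eq (u v : nat -> R) : u @ \oo --> (0 : R) -> u =1 v ->
  v @ \oo --> (0 : R).
Proof. by move=> + /funext <-. Qed.

Definition mprob (Z : eqType) (mu : seq (R * Z)) : Prop :=
  (forall p, p \in mu -> 0 <= p.1) /\ \sum_(p <- mu) p.1 = 1.

(** If all values at points of nonzero mass were strictly closer to [t] than the mean, averaging
    would give a contradiction. This reduces weak convergence to a Dirac mass to convergence of
    points picked from the supports. *)
Lemma mprob_mean (Z : eqType) (mu : seq (R * Z)) (phi : Z -> R) (t : R) :
  mprob mu ->
  exists p, [/\ p \in mu, p.1 != 0 & `|ev mu phi - t| <= `|phi p.2 - t|].
Proof.
move=> [mu0 mu1]; apply: contrapT => nex.
have lt p : p \in mu -> p.1 != 0 -> `|phi p.2 - t| < `|ev mu phi - t|.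
  move=> pmu p0; rewrite ltNge; apply/negP => le.
  by apply: nex; exists p.
have : `|ev mu phi - t| <= \sum_(p <- mu) p.1 * `|phi p.2 - t|.
  have -> : ev mu phi - t = \sum_(p <- mu) p.1 * (phi p.2 - t).
    under eq_bigr do rewrite mulrBr.
    by rewrite sumrB -mulr_suml mu1 mul1r.
  rewrite (le_trans (ler_norm_sum _ _ _))// big_seq [leRHS]big_seq.
  by apply: ler_sum => p pmu; rewrite normrM ger0_norm// mu0.
apply/negP; rewrite -ltNge -[ltRHS]mul1r -mu1 mulr_suml.
have sumE (F : R * Z -> R) : \sum_(p <- mu) p.1 * F p =
    \sum_(p <- mu | (p \in mu) && (p.1 != 0)) p.1 * F p.
  rewrite big_seq (bigID (fun p => p.1 != 0)) /= [X in _ + X]big1 ?addr0//.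
  by move=> p /andP[_ /negPn/eqP ->]; rewrite mul0r.
rewrite (sumE (fun p => `|phi p.2 - t|)) (sumE (fun=> `|ev mu phi - t|)).
apply: ltr_sum => [|p /andP[pmu p0]]; last first.
  by rewrite ltr_pM2l ?lt//  lt_neqAle eq_sym p0 mu0.
(* Strictness requires one point of nonzero mass, which exists as the total mass is 1. *)
apply: contrapT => /negP/hasPn np; have := oner_neq0 R; rewrite -mu1 big_seq.
by rewrite big1 ?eqxx// => p pmu; have := np p pmu; rewrite pmu /= negbK => /eqP.
Qed.

Lemma mprob_le (Z : eqType) (mu : seq (R * Z)) (phi : Z -> R) (C : R) :
  mprob mu -> (forall z, `|phi z| <= C) -> `|ev mu phi| <= C.
Proof.
move=> pmu phiC; have [p [_ _]] := mprob_mean phi 0 pmu.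
by rewrite !subr0 => /le_trans; apply.
Qed.

Lemma mprob_dirac (Z : eqType) (z : Z) : mprob (mdirac z).
Proof.
by split; [move=> p; rewrite inE => /eqP ->|rewrite big_seq1].
Qed.

Lemma mprob_map (Z V : eqType) (f : Z -> V) mu : mprob mu -> mprob (mmap f mu).
Proof.
by move=> [mu0 mu1]; split; [move=> _ /mapP[p /mu0 p0 ->]|rewrite big_map].
Qed.

Lemma mem_mbind (Z V : eqType) (mu : seq (R * Z)) (K : Z -> seq (R * V)) p :
  p \in mbind mu K ->
  exists q r, [/\ q \in mu, r \in K q.2 & p = (q.1 * r.1, r.2)].
Proof. by move=> /flatten_mapP[q qmu /mapP[r rK ->]]; exists q, r. Qed.

Lemma mprob_bind (Z V : eqType) (mu : seq (R * Z)) (K : Z -> seq (R * V)) :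
  mprob mu -> (forall z, mprob (K z)) -> mprob (mbind mu K).
Proof.
move=> [mu0 mu1] pK; split=> [p /mem_mbind[q [r [qmu rK ->]]]|].
  by rewrite mulr_ge0 ?mu0//; have [+ _] := pK q.2; apply.
have sumE (A : Type) (nu : seq (R * A)) :
    \sum_(p <- nu) p.1 = ev nu (fun=> 1) by apply: eq_bigr => p _; rewrite mulr1.
rewrite sumE ev_bind; transitivity (ev mu (fun=> 1)); last by rewrite -sumE.
by apply: eq_ev => z; rewrite -sumE; case: (pK z).
Qed.

(* The law of the list obtained by running through the indices [i < n] and
   applying [add i] with probability [a i], independently. *)
Fixpoint walk (add : nat -> seq nat -> seq nat) (a : nat -> R) (n : nat) :
    seq (R * seq nat) :=
  if n is m.+1 then
    mbind (walk add a m) (fun l => [:: (a m, add m l); (1 - a m, l)])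
  else mdirac [::].

(** * The random walk on lists of conditions *)

Section walk.
Variable add : nat -> seq nat -> seq nat.
Implicit Types a : nat -> R.

Lemma ev_walkS a n phi : ev (walk add a n.+1) phi =
  ev (walk add a n) (fun l => a n * phi (add n l) + (1 - a n) * phi l).
Proof.
by rewrite /= ev_bind; apply: eq_ev => l; rewrite /ev !big_cons big_nil addr0.
Qed.

Lemma ev_walk_stop a n m phi : (n <= m)%N ->
  (forall i, (n <= i)%N -> a i = 0) -> ev (walk add a m) phi = ev (walk add a n) phi.
Proof.
move=> /subnK <- a0; elim: (m - n)%N => [//|k IH].
rewrite addSn ev_walkS -IH; apply: eq_ev => l.
by rewrite a0 ?leq_addl// mul0r add0r subr0 mul1r.
Qed.

Lemma walk_prob a n : (forall i, 0 <= a i <= 1) -> mprob (walk add a n).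
Proof.
move=> a01; elim: n => [|n IH]; first exact: mprob_dirac.
apply: mprob_bind => // l; split=> [p|]; last first.
  by rewrite big_cons big_seq1 /= addrC subrK.
by have /andP[a0 a1] := a01 n; rewrite !inE => /orP[]/eqP -> //=; rewrite subr_ge0.
Qed.

(** Induction on [n]: the last step is absorbed into the test function, and changing its probability
    moves the mean by at most twice the change. As [phi] varies with [k], the convergence is uniform
    over bounded test functions. *)
Lemma walk_cvg (a_ : nat -> nat -> R) a n (phi : nat -> seq nat -> R) :
  (forall k i, 0 <= a_ k i <= 1) -> (forall i, 0 <= a i <= 1) ->
  (forall i, a_ ^~ i @ \oo --> a i) -> (forall k l, `|phi k l| <= 1) ->
  (fun k => ev (walk add (a_ k) n) (phi k) - ev (walk add a n) (phi k)) @ \oo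
    --> (0 : R).
Proof.
move=> a_01 a01 aa; elim: n phi => [|n IH] phi phi1.
  rewrite (_ : (fun _ => _) = fun=> 0); first exact: cvg_cst.
  by apply/funext => k; rewrite subrr.
pose psi (b : nat -> nat -> R) k l :=
  b k n * phi k (add n l) + (1 - b k n) * phi k l.
have psi1 b : (forall k i, 0 <= b k i <= 1) -> forall k l, `|psi b k l| <= 1.
  move=> b01 k l; have /andP[b0 b1] := b01 k n.
  have := phi1 k (add n l); have := phi1 k l; rewrite !ler_norml /psi.
  by move=> /andP[? ?] /andP[? ?]; apply/andP; split; nra.
have c1 := IH (psi a_) (psi1 _ a_01).
have c2 : (fun k => ev (walk add a n)
    (fun l => psi a_ k l - psi (fun=> a) k l)) @ \oo --> (0 : R).
  apply: (@cvg0_le _ (fun k => 2 * `|a_ k n - a n|)).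
    apply: nearW => k; apply: mprob_le; first exact: walk_prob.
    move=> l; rewrite /psi.
    rewrite (_ : _ - _ = (a_ k n - a n) * (phi k (add n l) - phi k l)); last by ring.
    rewrite normrM mulrC ler_wpM2r// (le_trans (ler_normB _ _))//.
    by rewrite -[2]/(1 + 1) lerD.
  rewrite -(mulr0 2); apply: cvgM; first exact: cvg_cst.
  by apply/norm_cvg0P; rewrite -(subrr (a n)); apply: cvgB (aa n) (cvg_cst _).
rewrite (_ : (fun _ => _) = (fun k => (ev (walk add (a_ k) n) (psi a_ k) -
    ev (walk add a n) (psi a_ k)) + ev (walk add a n)
    (fun l => psi a_ k l - psi (fun=> a) k l))); last first.
  by apply/funext => k; rewrite !ev_walkS evB addrA subrK.
by have := cvgD c1 c2; rewrite [0 + 0]addr0; exact.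
Qed.

End walk.

End weighted_lists.

(** * Probabilistic retractions *)

Section probabilistic_projection.
Context {R : realType}.

(** Test functions for weak convergence vary with the index and are equicontinuous only along
    convergent sequences. This covers Lipschitz functions as well as composites with convergent
    sequences of maps. *)
Definition probe (Z : topologicalType) (phi : nat -> Z -> R) : Prop :=
  (forall k z, `|phi k z| <= 1) /\
  forall (z_ : nat -> Z) z, z_ @ \oo --> z ->
    (fun k => phi k (z_ k) - phi k z) @ \oo --> (0 : R).

Definition mcvg (Z : topologicalType) (mu_ : nat -> seq (R * Z))
    (mu : seq (R * Z)) : Prop :=
  forall phi, probe phi ->
    (fun k => ev (mu_ k) (phi k) - ev mu (phi k)) @ \oo --> (0 : R).

Lemma mcvg_dirac (Z : topologicalType) (z_ : nat -> Z) z :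
  z_ @ \oo --> z -> mcvg (fun k => mdirac (z_ k)) (mdirac z).
Proof.
move=> zz phi [_ phiP]; under eq_fun do rewrite !ev_dirac; exact: phiP.
Qed.

(* [z |-> avg (mdirac z)] embeds [Z] in [W]. The closed conditions [test c = 0]
   play the role of a countable subbase: by [test_sep], the conditions that
   eventually hold along a sequence converging to the image of [z] suffice to
   force convergence to [z] in [Z]. *)
Record prob_embedding (Z W : topologicalType) := ProbEmbedding {
  avg : seq (R * Z) -> W ;
  avg_cvg : forall (mu_ : nat -> seq (R * Z)) mu,
    mcvg mu_ mu -> avg \o mu_ @ \oo --> avg mu ;
  origin : Z ;
  test : nat -> W -> R ;
  test_ge0 : forall c w, 0 <= test c w ;
  test_cvg : forall c, seq_continuous (test c : W -> R) ;
  test_sep : forall (B : nat -> set W) z,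
    (forall y_ : nat -> W, (forall k, B k (y_ k)) -> y_ @ \oo --> avg (mdirac z)) ->
    forall g : nat -> Z,
    (forall c, (exists n, forall w, B n w -> test c w = 0) ->
       \forall k \near \oo, test c (avg (mdirac (g k))) = 0) ->
    g @ \oo --> z ;
  dst : W -> R ;
  dst_ge0 : forall w, 0 <= dst w ;
  dst_cvg : seq_continuous (dst : W -> R) ;
  dst_eq0 : forall w, dst w = 0 <-> exists z, avg (mdirac z) = w }.

Definition clamp (x : R) : R := Num.max 0 (Num.min 1 x).

Lemma clamp_itv x : 0 <= clamp x <= 1.
Proof. by rewrite /clamp le_max lexx ge_max ler01 ge_min lexx. Qed.

Lemma clamp_le0 x : x <= 0 -> clamp x = 0.
Proof.
by move=> x0; apply/max_idPl; rewrite ge_min x0 orbT.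
Qed.

Lemma clamp_eq0 x : clamp x = 0 -> x <= 0.
Proof.
move=> c0; have : clamp x <= 0 by rewrite c0.
by rewrite /clamp ge_max lexx/= ge_min (lt_geF ltr01).
Qed.

Lemma clamp_ge1 x : 1 <= x -> clamp x = 1.
Proof. by move=> x1; rewrite /clamp (min_idPl x1); apply/max_idPr. Qed.

Lemma clamp_lipschitz x y : `|clamp x - clamp y| <= `|x - y|.
Proof.
wlog xy : x y / x <= y.
  by move=> H; have [/H//|/ltW/H] := leP x y; rewrite distrC (distrC y).
rewrite (ler0_norm (_ : x - y <= 0)) ?subr_le0// /clamp.
rewrite ler_norml; case: (leP 1 x) => ?; case: (leP 1 y) => ?;
  rewrite ?(max_idPr (ler01 : 0 <= 1 :> R));
  case: (leP 0 x) => ?; case: (leP 0 y) => ?; apply/andP; split; lra.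
Qed.

Lemma clamp_cvg (u : nat -> R) l : u @ \oo --> l -> clamp \o u @ \oo --> clamp l.
Proof.
move=> /cvgrPdist_le ul; apply/cvgrPdist_le => e /ul.
by apply: filterS => k; apply: le_trans; exact: clamp_lipschitz.
Qed.

Section theory.
Variables (Z W : topologicalType) (E : prob_embedding Z W).

Definition emb (z : Z) : W := avg E (mdirac z).

Lemma emb_cvg : seq_continuous emb.
Proof. by move=> z_ z zz; exact: avg_cvg (mcvg_dirac zz). Qed.

(** Apply [test_sep] to the tails of [w_]: choosing one term from each tail gives a sequence that
    converges with [w_]. *)
Lemma test_sep_seq (w_ : nat -> W) z (g : nat -> Z) :
  w_ @ \oo --> emb z ->
  (forall c, (\forall k \near \oo, test E c (w_ k) = 0) ->
     \forall k \near \oo, test E c (emb (g k)) = 0) ->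
  g @ \oo --> z.
Proof.
move=> wz gP.
apply: (@test_sep _ _ E (fun n => [set w_ k | k in [set k | (n <= k)%N]])).
  move=> y_ yP; have /choice[s sP] : forall k, exists j, (k <= j)%N /\ w_ j = y_ k.
    by move=> k; have [j kj jy] := yP k; exists j.
  have -> : y_ = w_ \o s by apply/funext => k /=; rewrite (sP k).2.
  apply: (cvg_comp _ _ _ wz) => A [M _ MA].
  by apply: filterS (nbhs_infty_ge M) => k Mk; apply: MA; exact: leq_trans Mk (sP k).1.
move=> c [n nP]; apply: gP; apply: filterS (nbhs_infty_ge n) => k nk.
by apply: nP; exists k.
Qed.

Lemma emb_inv_cvg (g : nat -> Z) z :
  (fun k => emb (g k)) @ \oo --> emb z -> g @ \oo --> z.
Proof. by move=> gz; apply: test_sep_seq gz _. Qed.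

Lemma test_lim_eq0 (w_ : nat -> W) w c : w_ @ \oo --> w ->
  (\forall k \near \oo, test E c (w_ k) = 0) -> test E c w = 0.
Proof.
move=> ww w0; have tc := @test_cvg _ _ E c _ _ ww.
have t0 : test E c \o w_ @ \oo --> (0 : R).
  apply: (@cvg0_le _ _ (fun=> 0)); last exact: cvg_cst.
  by apply: filterS w0 => k /= ->; rewrite normr0.
by apply: (cvg_unique (@Rhausdorff R)) tc t0.
Qed.

Definition meets (l : seq nat) (z : Z) : Prop :=
  forall c, c \in l -> test E c (emb z) = 0.

(** Lists of indices are countable, so the values form a countable subset of [Z]; [origin] is the
    default for conditions that no point meets. *)
Definition sample (l : seq nat) : Z :=
  if pselect (exists z, meets l z) is left h then sval (cid h) else origin E.

Lemma sampleP l z : meets l z -> meets l (sample l).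
Proof.
move=> lz; rewrite /sample; case: pselect => [h|[]]; last by exists z.
exact: svalP (cid h).
Qed.

Lemma meets_cat l1 l2 z : meets (l1 ++ l2) z <-> meets l1 z /\ meets l2 z.
Proof.
split=> [H|[H1 H2] c]; last by rewrite mem_cat => /orP[/H1|/H2].
by split=> c cl; apply: H; rewrite mem_cat cl ?orbT.
Qed.

(** Let [l_ k] list the conditions below [k] that hold at the image of [z]. Each of these is
    eventually imposed, so [test_sep_seq] along a constant sequence gives convergence; the prefix
    [l] keeps the samples among the points meeting [l]. *)
Lemma sample_dense l z : meets l z ->
  exists l_ : nat -> seq nat,
    (forall k, meets l (sample (l ++ l_ k))) /\
    (fun k => sample (l ++ l_ k)) @ \oo --> z.
Proof.
move=> lz; pose l_ k := [seq c <- iota 0 k | `[< test E c (emb z) = 0 >]].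
have l_z k : meets (l ++ l_ k) z.
  apply/meets_cat; split=> // c; rewrite mem_filter => /andP[/asboolP].
  by [].
have P k := sampleP (l_z k).
exists l_; split=> [k|]; first by have /meets_cat[] := P k.
apply: (@test_sep_seq (fun=> emb z)); first exact: cvg_cst.
move=> c [n _ /(_ n (leqnn n)) c0].
apply: filterS (nbhs_infty_gt c) => k ck.
have /meets_cat[_] := P k; apply.
by rewrite mem_filter mem_iota leq0n add0n ck !andbT; apply/asboolP.
Qed.

Definition greedy (c : nat) (l : seq nat) : seq nat :=
  if `[< exists z, meets (rcons l c) z >] then rcons l c else l.

(** For [d = dst E w > 0], this is 1 if condition [c] holds at [w] and [c * d <= 1]; it is 0 if
    [c * d >= 2] or if the test value is at least [2 * d]. *)
Definition chance (w : W) (c : nat) : R :=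
  clamp (2 - c%:R * dst E w - test E c w / dst E w).

(** Indices beyond [2 / d] have chance 0 at distance [d], so stopping here does not change the
    law. *)
Definition stage (d : R) : nat := (Num.trunc (2 / d)).+1.

Definition proj (w : W) : seq (R * Z) :=
  if pselect (exists z, emb z = w) is left h then mdirac (sval (cid h))
  else mmap sample (walk greedy (chance w) (stage (dst E w))).

Lemma walk_supp (a : nat -> R) n p : p \in walk greedy a n -> p.1 != 0 ->
  (exists z, meets p.2 z) /\ forall c, c \in p.2 -> (c < n)%N /\ a c != 0.
Proof.
elim: n p => [|n IH] p.
  rewrite inE => /eqP -> _ /=; split=> //; exists (origin E) => c.
  by rewrite in_nil.
move=> /mem_mbind[q [r [qw rl ->]]] /=; rewrite mulf_eq0 => /norP[q0 r0].
have [ql qP] := IH q qw q0; move: rl r0; rewrite !inE => /orP[]/eqP -> /= an.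
  rewrite /greedy; case: asboolP => [lP|_]; split=> // c.
    rewrite mem_rcons inE => /predU1P[->|/qP[cn ac]]; first by rewrite ltnSn.
    by split=> //; apply: ltnW.
  by move=> /qP[cn ac]; split=> //; apply: ltnW.
by split=> // c /qP[cn ac]; split=> //; apply: ltnW.
Qed.

(** Indices kept before [c] have nonzero chance, hence are conditions met by [z]. So [z] witnesses
    that [c] can be added, which then happens with probability 1. *)
Lemma walk_hit (a : nat -> R) n c z p :
  (c < n)%N -> a c = 1 -> test E c (emb z) = 0 ->
  (forall i, (i < c)%N -> test E i (emb z) <> 0 -> a i = 0) ->
  p \in walk greedy a n -> p.1 != 0 -> c \in p.2.
Proof.
move=> + ac cz small; elim: n p => [//|n IH] p.
rewrite ltnS leq_eqVlt => cn /mem_mbind[q [r [qw rl ->]]] /=.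
rewrite mulf_eq0 => /norP[q0 r0].
(* An index once kept is never dropped. *)
have sub b : (r.1 == b) || true -> c \in q.2 -> c \in r.2.
  move=> _ cq; move: rl; rewrite !inE => /orP[]/eqP -> //=; rewrite /greedy.
  by case: ifP => // _; rewrite mem_rcons inE cq orbT.
move: cn => /predU1P[cn|cn]; last by apply: (sub 0); rewrite ?orbT// IH.
move: rl r0; rewrite !inE => /orP[]/eqP -> /=; last by rewrite -cn ac subrr eqxx.
move=> _; rewrite /greedy; case: asboolP => [_|].
  by rewrite -cn mem_rcons mem_head.
move=> []; exists z => i; rewrite -cn mem_rcons inE => /predU1P[->//|iq].
have [_ /(_ i iq)[ic ai]] := walk_supp qw q0.
by apply: contrapT => iz; move: ai; rewrite small ?eqxx// cn.
Qed.

Lemma chance_itv w c : 0 <= chance w c <= 1.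
Proof. exact: clamp_itv. Qed.

Lemma chance_stop w c (d : R) :
  0 < d -> d <= dst E w -> (stage d <= c)%N -> chance w c = 0.
Proof.
move=> d0 dw dc; apply: clamp_le0; rewrite subr_le0.
apply: (@le_trans _ _ 0); last by rewrite divr_ge0 ?test_ge0 ?dst_ge0.
rewrite subr_le0 (@le_trans _ _ (c%:R * d))//; last by rewrite ler_wpM2l.
rewrite -ler_pdivrMr// ltW// (lt_le_trans (truncnS_gt _))//.
by rewrite ler_nat.
Qed.

Lemma chance_far w c : 0 < dst E w -> 2 * dst E w <= test E c w -> chance w c = 0.
Proof.
move=> d0 dc; apply: clamp_le0; rewrite -addrA -opprD subr_le0.
by rewrite -[leLHS]add0r lerD ?mulr_ge0 ?dst_ge0// ler_pdivlMr.
Qed.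

Lemma chance_eq1 w c : test E c w = 0 -> c%:R * dst E w <= 1 -> chance w c = 1.
Proof. by move=> c0 cd; apply: clamp_ge1; rewrite c0 mul0r subr0; lra. Qed.

Lemma chance_cvg (w_ : nat -> W) w c : w_ @ \oo --> w -> 0 < dst E w ->
  (fun k => chance (w_ k) c) @ \oo --> chance w c.
Proof.
move=> ww dw; apply: clamp_cvg.
have dc := @dst_cvg _ _ E _ _ ww; have tc := @test_cvg _ _ E c _ _ ww.
apply: cvgB; last by apply: cvgM tc _; apply: cvgV dc; rewrite gt_eqF.
by apply: cvgB; [exact: cvg_cst|apply: cvgM dc; exact: cvg_cst].
Qed.

Lemma proj_prob w : mprob (proj w).
Proof.
rewrite /proj; case: pselect => [h|_]; first exact: mprob_dirac.
by apply: mprob_map; apply: walk_prob => i; exact: chance_itv.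
Qed.

Lemma dst_gt0 w : ~ (exists z, emb z = w) -> 0 < dst E w.
Proof.
move=> nw; rewrite lt_neqAle dst_ge0 andbT eq_sym; apply/eqP => d0.
by apply: nw; apply/dst_eq0.
Qed.

(** By [mprob_mean] it suffices that certain points [p k] of nonzero mass in [proj (w_ k)] converge
    to [z]. A condition that eventually holds along [w_] holds at the image of [z]. Once [dst] is
    small, its chance is 1 and earlier conditions failing at [z] have chance 0, so by [walk_hit] it
    is imposed on [p k]; then [test_sep_seq] applies. *)
Lemma proj_cvg_emb (w_ : nat -> W) z : w_ @ \oo --> emb z ->
  mcvg (fun k => proj (w_ k)) (mdirac z).
Proof.
move=> wz phi [phi1 phiP]; under eq_fun do rewrite ev_dirac.
have /choice[p pP] := fun k => mprob_mean (phi k) (phi k z) (proj_prob (w_ k)).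
suff pz : (fun k => (p k).2) @ \oo --> z.
  apply: (@cvg0_le _ _ (fun k => `|phi k (p k).2 - phi k z|)).
    by apply: nearW => k; have [] := pP k.
  by apply/norm_cvg0P; exact: phiP pz.
apply: (test_sep_seq wz) => c c0.
have cz : test E c (emb z) = 0 := test_lim_eq0 wz c0.
have dz : (fun k => dst E (w_ k)) @ \oo --> (0 : R).
  rewrite -(proj2 (@dst_eq0 _ _ E (emb z))); first exact: (@dst_cvg _ _ E _ _ wz).
  by exists z.
have small : \forall k \near \oo, c%:R * dst E (w_ k) < 1.
  have : (fun k => c%:R * dst E (w_ k)) @ \oo --> (0 : R).
    by rewrite -(mulr0 c%:R); apply: cvgM dz; exact: cvg_cst.
  by move=> /cvgr_lt; apply.
(* A condition failing at [z] has test values bounded away from 0, while the tolerance [2 * dst]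
   tends to 0. *)
have far : \forall k \near \oo, forall i, (i < c)%N ->
    test E i (emb z) <> 0 -> 2 * dst E (w_ k) < test E i (w_ k).
  apply: near_forall_ltn => i _.
  have [iz|iz] := pselect (test E i (emb z) = 0); first by apply: nearW.
  have : (fun k => test E i (w_ k) - 2 * dst E (w_ k)) @ \oo -->
      test E i (emb z) - 2 * 0.
    apply: cvgB; first exact: (@test_cvg _ _ E i _ _ wz).
    by apply: cvgM dz; exact: cvg_cst.
  rewrite mulr0 subr0 => /cvgr_gt/(_ 0).
  rewrite lt_neqAle test_ge0 andbT eq_sym => /(_ (introN eqP iz)).
  by apply: filterS => k /= ? _; rewrite -subr_gt0.
apply: filterS3 c0 small far => k ck sk fk.
have [+ p0 _] := pP k; move: (p k) p0 => {p pP} p p0; rewrite /proj.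
(* On the image, [p] is the preimage itself and the condition holds there directly. *)
case: pselect => [h|nh].
  by rewrite inE => /eqP -> /=; rewrite (svalP (cid h)).
move=> /mapP[q qw pq]; move: p0; rewrite pq /= => q0 {pq p}.
have d0 := dst_gt0 nh.
have [[y qy] _] := walk_supp qw q0; apply: (sampleP qy).
apply: walk_hit cz _ qw q0.
- rewrite -(ltr_nat R) (lt_trans _ (truncnS_gt _))// ltr_pdivlMr//.
  by rewrite (lt_trans sk)// ltr1n.
- by apply: chance_eq1 => //; exact: ltW.
- by move=> i ic iz; apply: chance_far => //; apply/ltW/fk.
Qed.

Lemma emb_inj : hausdorff_space Z -> injective emb.
Proof.
move=> hZ x y xy; apply: (cvg_unique hZ (F := (fun _ : nat => x) @ \oo)).
  exact: cvg_cst.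
by apply: emb_inv_cvg; rewrite xy; exact: cvg_cst.
Qed.

(** Constant sequences turn [test_sep_seq] into separation of points. *)
Lemma test_emb_inj x y : hausdorff_space Z ->
  (forall c, test E c (emb x) = test E c (emb y)) -> x = y.
Proof.
move=> hZ xy; apply/esym/(cvg_unique hZ (F := (fun _ : nat => y) @ \oo)).
  exact: cvg_cst.
apply: (@test_sep_seq (fun=> emb x)); first exact: cvg_cst.
by move=> c; rewrite xy.
Qed.

Lemma proj_emb z : hausdorff_space Z -> proj (emb z) = mdirac z.
Proof.
move=> hZ; rewrite /proj; case: pselect => [h|[]]; last by exists z.
by rewrite (emb_inj hZ (svalP (cid h))).
Qed.

(** Additional steps have chance 0, so one number of stages serves all points at distance at least
    [d], which makes their laws comparable. *)
Lemma ev_proj w (d : R) phi : 0 < d -> d <= dst E w ->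
  ev (proj w) phi = ev (walk greedy (chance w) (stage d)) (phi \o sample).
Proof.
move=> d0 dw; have w0 := lt_le_trans d0 dw; rewrite /proj; case: pselect => [h|_].
  by move: w0; rewrite (proj2 (@dst_eq0 _ _ E w) h) ltxx.
rewrite ev_map; apply/esym/ev_walk_stop => [|i]; last exact: chance_stop.
by rewrite ltnS truncn_le_nat (le_lt_trans _ (truncnS_gt _))// ler_pM2l// lef_pV2.
Qed.

(** On the image this is [proj_cvg_emb]. Off it, [dst] eventually exceeds half its limit, so the
    number of stages can be fixed, and the chances of these finitely many steps converge. *)
Lemma proj_cvg (w_ : nat -> W) w : hausdorff_space Z -> w_ @ \oo --> w ->
  mcvg (fun k => proj (w_ k)) (proj w).
Proof.
move=> hZ ww; have [[z zw]|/dst_gt0 w0] := pselect (exists z, emb z = w).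
  by rewrite -zw proj_emb//; apply: proj_cvg_emb; rewrite zw.
move=> phi [phi1 _]; pose d := dst E w / 2.
have d0 : 0 < d by rewrite divr_gt0.
have dw : d < dst E w by rewrite ltr_pdivrMr// ltr_pMr// ltr1n.
have dk : \forall k \near \oo, d < dst E (w_ k).
  by apply: cvgr_gt dw; exact: (@dst_cvg _ _ E _ _ ww).
have : (fun k => ev (walk greedy (chance (w_ k)) (stage d)) (phi k \o sample) -
    ev (walk greedy (chance w) (stage d)) (phi k \o sample)) @ \oo --> (0 : R).
  apply: walk_cvg => [k i|i|i|k l]; [exact: chance_itv|exact: chance_itv| |exact: phi1].
  exact: chance_cvg.
apply: cvg_trans; apply: near_eq_cvg; apply: filterS dk => k dk.
by rewrite -!ev_proj// ltW.
Qed.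

End theory.
End probabilistic_projection.

(** * Function types *)

Section zero_sets.
Context {R : realType} {W : topologicalType}.

(** Take the supremum of [clamp (phi i w) / i.+1]. The terms tend to 0 uniformly in [w], so up to a
    given error only finitely many matter for continuity. *)
Lemma zero_set_bigcap (phi : nat -> W -> R) :
  (forall i w, 0 <= phi i w) -> (forall i, seq_continuous (phi i : W -> R)) ->
  exists Phi : W -> R,
    [/\ forall w, 0 <= Phi w, seq_continuous (Phi : W -> R) &
        forall w, Phi w = 0 <-> forall i, phi i w = 0].
Proof.
move=> phi0 phic; pose t w i := clamp (phi i w) / i.+1%:R.
have t0 w i : 0 <= t w i by rewrite divr_ge0//; have /andP[] := clamp_itv (phi i w).
have t1 w i : t w i <= i.+1%:R^-1.
  by rewrite ler_piMl// ?invr_ge0//; have /andP[] := clamp_itv (phi i w).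
pose Phi w := sup (range (t w)).
have supt w : has_sup (range (t w)).
  split; first by exists (t w 0%N); exists 0%N.
  exists 1 => _ [i _ <-]; apply: le_trans (t1 w i) _.
  by rewrite invf_le1// ler1n.
have tPhi w i : t w i <= Phi w by apply: sup_upper_bound => //; exists i.
have Phile w c : (forall i, t w i <= c) -> Phi w <= c.
  by move=> tc; apply: ge_sup => [|_ [i _ <-]//]; case: (supt w).
exists Phi; split=> [w|w_ w ww|w].
- exact: le_trans (t0 w 0%N) (tPhi w 0%N).
- apply/cvgrPdist_le => /= e e0.
  pose N := Num.trunc e^-1.
  have iN i : (N <= i)%N -> i.+1%:R^-1 <= e.
    move=> Ni; rewrite -[leRHS]invrK lef_pV2 ?posrE ?invr_gt0//.
    by apply: ltW; rewrite (lt_le_trans (truncnS_gt _))// ler_nat.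
  have : \forall k \near \oo, forall i, (i < N)%N -> `|phi i w - phi i (w_ k)| <= e.
    apply: near_forall_ltn => i _.
    by have /cvgrPdist_le := phic i _ _ ww; apply.
  apply: filterS => k Hk.
  have tk i : `|t w i - t (w_ k) i| <= e.
    have [iN'|/iN ie] := ltnP i N.
      apply: le_trans (Hk i iN'); apply: le_trans (clamp_lipschitz _ _).
      rewrite -mulrBl normrM ler_piMr// ger0_norm ?invr_ge0//.
      by rewrite invf_le1// ler1n.
    rewrite ler_norml; have := t0 w i; have := t0 (w_ k) i.
    have := le_trans (t1 w i) ie; have := le_trans (t1 (w_ k) i) ie.
    by move=> *; apply/andP; split; lra.
  have le1 : Phi (w_ k) <= Phi w + e.
    apply: Phile => i; have := tk i; have := tPhi w i.
    by rewrite ler_norml => ? /andP[? ?]; lra.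
  have le2 : Phi w <= Phi (w_ k) + e.
    apply: Phile => i; have := tk i; have := tPhi (w_ k) i.
    by rewrite ler_norml => ? /andP[? ?]; lra.
  by rewrite ler_norml; apply/andP; split; lra.
- split=> [Pw i|pw].
    apply/le_anti; rewrite phi0 andbT; apply: clamp_eq0; apply/le_anti.
    have := tPhi w i; rewrite Pw /t ler_pdivrMr// mul0r => ->.
    by have /andP[] := clamp_itv (phi i w).
  apply/eqP; rewrite eq_le (le_trans (t0 w 0%N) (tPhi w 0%N)) andbT.
  by apply: Phile => i; rewrite /t pw clamp_le0// mul0r.
Qed.

Lemma zero_set_bigcap_countable (I : countType) (phi : I -> W -> R) :
  (forall i w, 0 <= phi i w) -> (forall i, seq_continuous (phi i : W -> R)) ->
  exists Phi : W -> R,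
    [/\ forall w, 0 <= Phi w, seq_continuous (Phi : W -> R) &
        forall w, Phi w = 0 <-> forall i, phi i w = 0].
Proof.
move=> phi0 phic.
have [||Phi [P0 Pc PP]] := @zero_set_bigcap
    (fun n w => if unpickle n is Some i then phi i w else 0).
- by move=> n w; case: unpickle.
- move=> n; case: unpickle => [i|]; first exact: phic.
  by move=> x_ x _; exact: cvg_cst.
exists Phi; split=> // w; rewrite PP; split=> H i; last by case: unpickle.
by have := H (pickle i); rewrite pickleK.
Qed.

End zero_sets.

Lemma seq_fun_hausdorff (X Y : topologicalType) :
  hausdorff_space Y -> hausdorff_space (seq_fun X Y).
Proof.
move=> hY f g fg; apply: seq_funP => x; apply: hY => A B Afx Bgx.
have evc : continuous (fun h : seq_fun X Y => h x).
  apply: seq_continuous_continuous; first exact: seq_fun_sequential.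
  by move=> h_ h /seq_fun_cvgP hh; apply: (hh (fun=> x)); exact: cvg_cst.
have [h [/= Ahx Bhx]] := fg _ _ (evc f A Afx) (evc g B Bgx).
by exists (h x).
Qed.

Lemma seq_cst_fun (X Y : topologicalType) (y : Y) :
  exists f : seq_fun X Y, forall x, f x = y.
Proof.
pose c := isContinuous.Build X Y (fun=> y) (@cst_continuous X Y y).
pose g : continuousType X Y := HB.pack (fun _ : X => y) c.
by exists (g : seq_fun X Y).
Qed.

(** * The inductive step at an arrow type *)

Section arrow.
Context {R : realType} {Zs Ws Zt Wt Vs Vt : topologicalType}.
Variables (Es : @prob_embedding R Zs Ws) (Et : @prob_embedding R Zt Wt).
Variables (Fs : @prob_embedding R Ws Vs) (Ft : @prob_embedding R Wt Vt).
Hypotheses (sZs : sequential Zs) (sWs : sequential Ws).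
Hypotheses (hZs : hausdorff_space Zs) (hZt : hausdorff_space Zt).
Hypotheses (hWt : hausdorff_space Wt).

(** The law of [f x] for [f] drawn from [mu] and [x] drawn independently from [proj Es v]. *)
Definition avg_at (mu : seq (R * seq_fun Zs Zt)) (v : Ws) : seq (R * Zt) :=
  mbind mu (fun f => mmap f (proj Es v)).

Lemma ev_avg_at mu v phi :
  ev (avg_at mu v) phi = ev mu (fun f => ev (proj Es v) (phi \o f)).
Proof. by rewrite ev_bind; apply: eq_ev => f; rewrite ev_map. Qed.

Lemma probe_comp (phi : nat -> Zt -> R) (f : seq_fun Zs Zt) :
  probe phi -> probe (fun k => phi k \o f).
Proof.
move=> [phi1 phiP]; split=> [k z|z_ z zz]; first exact: phi1.
apply: (phiP (f \o z_)).
exact: continuous_seq_continuous (@seq_fun_continuous _ _ f) _ _ zz.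
Qed.

(** The difference of [phi k \o f_ k] and [phi k \o f] tends to 0 along convergent sequences, so up
    to a factor it is a probe. Weak convergence then replaces [proj Es (v_ k)] by the fixed finite
    law [proj Es v], for which pointwise convergence suffices. *)
Lemma cvg_proj_seq_fun (phi : nat -> Zt -> R) (f_ : nat -> seq_fun Zs Zt)
    (f : seq_fun Zs Zt) (v_ : nat -> Ws) (v : Ws) :
  probe phi -> f_ @ \oo --> f -> v_ @ \oo --> v ->
  (fun k => ev (proj Es (v_ k)) (phi k \o f_ k) -
    ev (proj Es (v_ k)) (phi k \o f)) @ \oo --> (0 : R).
Proof.
move=> [phi1 phiP] /seq_fun_cvgP ff vv.
have fc (z_ : nat -> Zs) (z : Zs) : z_ @ \oo --> z -> f \o z_ @ \oo --> f z.
  exact: continuous_seq_continuous (@seq_fun_continuous _ _ f) z_ z.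
(* Halving keeps the bound 1 required of a probe. *)
pose chi k z := (phi k (f_ k z) - phi k (f z)) / 2.
have chi0 (z_ : nat -> Zs) (z : Zs) :
    z_ @ \oo --> z -> (fun k => chi k (z_ k)) @ \oo --> (0 : R).
  move=> zz; apply: (@cvg0_eq _ (fun k => ((phi k (f_ k (z_ k)) - phi k (f z)) -
      (phi k (f (z_ k)) - phi k (f z))) / 2)); last first.
    by move=> k; rewrite opprB addrA subrK.
  rewrite -(mul0r (2^-1 : R)); apply: cvgM; last exact: cvg_cst.
  rewrite -[X in _ --> X](subrr (0 : R)); apply: cvgB; first exact: phiP (ff _ _ zz).
  exact: phiP (fc _ _ zz).
have chiP : probe chi.
  split=> [k z|z_ z zz].
    rewrite normrM (@ger0_norm _ 2^-1)// ler_pdivrMr// mul1r.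
    apply: le_trans (ler_normB _ _) _.
    by have := phi1 k (f_ k z); have := phi1 k (f z) => *; lra.
  rewrite -[X in _ --> X](subrr (0 : R)); apply: cvgB; first exact: chi0 zz.
  by apply: (chi0 (fun=> z)); exact: cvg_cst.
have c1 := proj_cvg Es hZs vv chiP.
have c2 : (fun k => ev (proj Es v) (chi k)) @ \oo --> (0 : R).
  by apply: ev_cvg0 => z; apply: (chi0 (fun=> z)); exact: cvg_cst.
have c3 : (fun k => (ev (proj Es (v_ k)) (chi k) - ev (proj Es v) (chi k) +
    ev (proj Es v) (chi k)) * 2) @ \oo --> (0 : R).
  rewrite -(mul0r (2 : R)); apply: cvgM; last exact: cvg_cst.
  by rewrite -[X in _ --> X](addr0 (0 : R)); exact: cvgD.
apply: (cvg0_eq c3) => k /=.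
rewrite subrK -evB /ev mulr_suml.
by apply: eq_bigr => p _; rewrite -mulrA divfK.
Qed.

(** Integrating over [proj Es (v_ k)] first turns [phi] into a probe on the function space, to which
    the convergence of [mu_] applies; for the fixed finite [mu], the retraction is passed to the
    limit function by function. *)
Lemma mcvg_avg_at mu_ mu (v_ : nat -> Ws) (v : Ws) : mcvg mu_ mu -> v_ @ \oo --> v ->
  mcvg (fun k => avg_at (mu_ k) (v_ k)) (avg_at mu v).
Proof.
move=> mm vv phi phiP.
pose psi k f := ev (proj Es (v_ k)) (phi k \o (f : seq_fun Zs Zt)).
have psiP : probe psi.
  split=> [k f|f_ f ff]; last exact: cvg_proj_seq_fun phiP ff vv.
  by apply: mprob_le => [|z]; [exact: proj_prob|exact: phiP.1].
have c2 : (fun k => ev mu (fun f => psi k f - ev (proj Es v) (phi k \o f)))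
    @ \oo --> (0 : R).
  by apply: ev_cvg0 => f; have := proj_cvg Es hZs vv (probe_comp f phiP).
apply: (@cvg0_eq _ (fun k => (ev (mu_ k) (psi k) - ev mu (psi k)) +
    ev mu (fun f => psi k f - ev (proj Es v) (phi k \o f)))) => [|k]; last first.
  by rewrite !ev_avg_at evB addrA subrK.
by rewrite -[X in _ --> X](addr0 (0 : R)); apply: cvgD c2; exact: mm.
Qed.

Lemma mcvg_cst (Z : topologicalType) (mu : seq (R * Z)) : mcvg (fun=> mu) mu.
Proof. by move=> phi _; under eq_fun do rewrite subrr; exact: cvg_cst. Qed.

Lemma avg_at_fun mu : exists g : seq_fun Ws Wt, forall v, g v = avg Et (avg_at mu v).
Proof.
apply: (seq_fun_of sWs) => v_ v vv.
exact: avg_cvg (mcvg_avg_at (mcvg_cst mu) vv).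
Qed.

Definition avg_fun mu : seq_fun Ws Wt := sval (cid (avg_at_fun mu)).

Lemma avg_funE mu v : avg_fun mu v = avg Et (avg_at mu v).
Proof. exact: (svalP (cid (avg_at_fun mu))). Qed.

Lemma avg_fun_cvg (mu_ : nat -> seq (R * seq_fun Zs Zt)) mu :
  mcvg mu_ mu -> avg_fun \o mu_ @ \oo --> avg_fun mu.
Proof.
move=> mm; apply/seq_fun_cvgP => v_ v vv; rewrite avg_funE.
rewrite (_ : (fun _ => _) = fun k => avg Et (avg_at (mu_ k) (v_ k))); last first.
  by apply/funext => k; rewrite /= avg_funE.
exact: (@avg_cvg _ _ _ Et _ _ (mcvg_avg_at mm vv)).
Qed.

(** The law attached to the image of [x] is the Dirac mass at [x], so averaging [f] over it extends
    [f]. *)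
Lemma avg_fun_dirac_emb f x : avg_fun (mdirac f) (emb Es x) = emb Et (f x).
Proof.
by rewrite avg_funE /avg_at (proj_emb Es x hZs) /mdirac /mbind /mmap /= mulr1.
Qed.

Lemma seq_fun_seq_continuous (X Y : topologicalType) (f : seq_fun X Y) :
  seq_continuous f.
Proof. exact: continuous_seq_continuous (@seq_fun_continuous _ _ f). Qed.

Lemma seq_fun_eval_cvg (X Y : topologicalType) (v : X) :
  seq_continuous (fun w : seq_fun X Y => w v).
Proof. by move=> w_ w /seq_fun_cvgP ww; apply: (ww (fun=> v)); exact: cvg_cst. Qed.

Lemma seq_continuous_comp (X Y Z : topologicalType) (f : X -> Y) (g : Y -> Z) :
  seq_continuous f -> seq_continuous g -> seq_continuous (g \o f).
Proof. by move=> cf cg x_ x xx; exact: cg (cf _ _ xx). Qed.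

(** The implication from [p] to [q] need only be tested at those samples of lists [p ++ l] that meet
    [p]: by [sample_dense] they approximate every point meeting [p]. *)
Lemma arrow_test (p : seq nat) (q : nat) : exists T : seq_fun Ws Wt -> R,
  [/\ forall w, 0 <= T w, seq_continuous (T : _ -> R) &
    forall w, T w = 0 <-> forall y, meets Es p y -> test Et q (w (emb Es y)) = 0].
Proof.
have [||T [T0 Tc TP]] := @zero_set_bigcap_countable R (seq_fun Ws Wt) (seq nat)
    (fun l w => if pselect (meets Es p (sample Es (p ++ l)))
       then test Et q (w (emb Es (sample Es (p ++ l)))) else 0).
- by move=> l w; case: pselect => // ?; exact: test_ge0.
- move=> l; case: pselect => [?|?]; last by move=> x_ x _; exact: cvg_cst.
  exact: seq_continuous_comp (@seq_fun_eval_cvg _ _ _) (@test_cvg _ _ _ Et q).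
exists T; split=> // w; rewrite TP; split=> [H y py|H l]; last first.
  by case: pselect => // ?; exact: H.
have [l_ [lp ly]] := sample_dense py.
apply: (@test_lim_eq0 _ _ _ Et (fun k => w (emb Es (sample Es (p ++ l_ k))))).
  exact: (@seq_fun_seq_continuous _ _ w _ _ (@emb_cvg _ _ _ Es _ _ ly)).
apply: nearW => k; have := H (l_ k).
by case: pselect => // nm; have := nm (lp k).
Qed.

(** For [x_] converging to [x], let [l n] list the conditions below [n] that eventually hold along
    [x_]. Points meeting [l n] converge to [x], so the sets [D n] of values there of maps in [B n]
    shrink to the image of [f x]. If [q] holds on [D n], the implication from [l n] to [q] holds on
    [B n], hence eventually for [g k], and [q] holds at its value at [x_ k]. Then [test_sep] for
    [Et] applies. *)
Lemma arrow_test_sep (f : seq_fun Zs Zt) (B : nat -> set (seq_fun Ws Wt))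
    (g : nat -> seq_fun Zs Zt) :
  (forall y_ : nat -> seq_fun Ws Wt, (forall k, B k (y_ k)) ->
     y_ @ \oo --> avg_fun (mdirac f)) ->
  (forall p q, (exists n, forall w, B n w -> forall y, meets Es p y ->
       test Et q (w (emb Es y)) = 0) ->
     \forall k \near \oo, forall y, meets Es p y ->
       test Et q (avg_fun (mdirac (g k)) (emb Es y)) = 0) ->
  g @ \oo --> f.
Proof.
move=> Bf gB; apply/seq_fun_cvgP => x_ x xx.
pose ok c := \forall k \near \oo, test Es c (emb Es (x_ k)) = 0.
pose l n := [seq c <- iota 0 n | `[< ok c >]].
have lx y_ : (forall k, meets Es (l k) (y_ k)) -> y_ @ \oo --> x.
  move=> yl; apply: (test_sep_seq (@emb_cvg _ _ _ Es _ _ xx)) => c okc.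
  apply: filterS (nbhs_infty_gt c) => k ck; apply: yl.
  by rewrite mem_filter mem_iota leq0n add0n ck !andbT; apply/asboolP.
pose D n :=
  [set u : Wt | exists w y, [/\ B n w, meets Es (l n) y & u = w (emb Es y)]].
apply: (@test_sep _ _ _ Et D).
  move=> u_ uD.
  have /choice[wy wyP] : forall n, exists wy : seq_fun Ws Wt * Zs,
      [/\ B n wy.1, meets Es (l n) wy.2 & u_ n = wy.1 (emb Es wy.2)].
    by move=> n; have [w [y ?]] := uD n; exists (w, y).
  rewrite (_ : u_ = fun n => (wy n).1 (emb Es (wy n).2)); last first.
    by apply/funext => n; have [] := wyP n.
  rewrite -/(emb Et (f x)) -avg_fun_dirac_emb.
  have /seq_fun_cvgP : (fun n => (wy n).1) @ \oo --> avg_fun (mdirac f).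
    by apply: Bf => n; have [] := wyP n.
  apply; apply: emb_cvg; apply: lx => n; by have [] := wyP n.
move=> q [n nP].
have xl : \forall k \near \oo, forall c, (c < n)%N -> c \in l n ->
    test Es c (emb Es (x_ k)) = 0.
  apply: near_forall_ltn => c _; case: (boolP (c \in l n)) => [|_].
    by rewrite mem_filter => /andP[/asboolP okc _]; apply: filterS okc.
  by apply: nearW.
have gl : \forall k \near \oo, forall y, meets Es (l n) y ->
    test Et q (avg_fun (mdirac (g k)) (emb Es y)) = 0.
  by apply: gB; exists n => w Bw y ly; apply: nP; exists w, y.
apply: filterS2 xl gl => k xk gk.
rewrite -/(emb Et _) -avg_fun_dirac_emb; apply: gk => c cl; apply: xk => //.
by move: cl; rewrite mem_filter mem_iota add0n => /and3P[].
Qed.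

(* Applied to the image of [f] at [v], this returns the value at [v] of the image
   of [f]; unlike that value it is defined for every [w]. *)
Definition reprojected (v : Ws) (w : seq_fun Ws Wt) : Wt :=
  avg Et (mbind (proj Es v) (fun x => proj Et (w (emb Es x)))).

Lemma reprojected_cvg v : seq_continuous (reprojected v).
Proof.
move=> w_ w ww; apply: avg_cvg => phi phiP.
apply: (@cvg0_eq _ (fun k => ev (proj Es v) (fun x =>
  ev (proj Et (w_ k (emb Es x))) (phi k) - ev (proj Et (w (emb Es x))) (phi k)))).
  apply: ev_cvg0 => x.
  by have := proj_cvg Et hZt (@seq_fun_eval_cvg _ _ (emb Es x) _ _ ww) phiP.
by move=> k; rewrite !ev_bind evB.
Qed.

Lemma reprojectedE v (w : seq_fun Ws Wt) (f : seq_fun Zs Zt) :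
  (forall x, w (emb Es x) = emb Et (f x)) -> reprojected v w = avg_fun (mdirac f) v.
Proof.
move=> wf; rewrite avg_funE /reprojected; congr (avg Et _).
rewrite /avg_at /mbind /mdirac /= cats0 /mmap -map_comp.
elim: (proj Es v) => //= p mu ->; rewrite wf (proj_emb Et _ hZt) /=.
by rewrite mulr1 mul1r.
Qed.

(** The image consists of the [w] that map the image of [Zs] into that of [Zt] and agree with
    [reprojected]. Countably many equations express this: samples of [Es] and [Fs] are dense in [Zs]
    and [Ws], and the tests of [Ft] separate points of [Wt]. *)
Lemma arrow_dst : exists D : seq_fun Ws Wt -> R,
  [/\ forall w, 0 <= D w, seq_continuous (D : _ -> R) &
    forall w, D w = 0 <-> exists f, avg_fun (mdirac f) = w].
Proof.
pose phi (i : seq nat + nat * seq nat) (w : seq_fun Ws Wt) : R :=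
  match i with
  | inl l => dst Et (w (emb Es (sample Es l)))
  | inr (j, l) => let v := sample Fs l in
      `|test Ft j (emb Ft (w v)) - test Ft j (emb Ft (reprojected v w))|
  end.
have testFt j : seq_continuous (fun u => test Ft j (emb Ft u) : R).
  exact: seq_continuous_comp (@emb_cvg _ _ _ Ft) (@test_cvg _ _ _ Ft j).
have [||D [D0 Dc DP]] := @zero_set_bigcap_countable R (seq_fun Ws Wt) _ phi.
- by move=> [l|[j l]] w /=; [exact: dst_ge0|exact: normr_ge0].
- move=> [l|[j l]].
    exact: seq_continuous_comp (@seq_fun_eval_cvg _ _ _) (@dst_cvg _ _ _ Et).
  move=> w_ w ww; apply: cvg_norm; apply: cvgB.
    exact: seq_continuous_comp (@seq_fun_eval_cvg _ _ _) (testFt j) _ _ ww.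
  exact: seq_continuous_comp (@reprojected_cvg _) (testFt j) _ _ ww.
exists D; split=> // w; rewrite DP; split=> [H|[f <-] [l|[j l]]] /=; last first.
- rewrite (@reprojectedE _ _ f) ?subrr ?normr0// => x.
  exact: avg_fun_dirac_emb.
- by apply/dst_eq0; exists (f (sample Es l)); rewrite avg_fun_dirac_emb.
(* The zero set of [dst Et] is sequentially closed, so the equations at the samples extend to all
   [x]. *)
have /choice[f fP] : forall x, exists z, emb Et z = w (emb Es x).
  move=> x; apply/dst_eq0.
  have [l_ [_ lx]] := @sample_dense _ _ _ Es [::] x (fun _ _ => ltac:(by [])).
  have dx : (fun k => dst Et (w (emb Es (sample Es (l_ k))))) @ \oo -->
      dst Et (w (emb Es x)).
    apply: (@dst_cvg _ _ _ Et); apply: (@seq_fun_seq_continuous _ _ w).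
    exact: (@emb_cvg _ _ _ Es).
  apply: (cvg_unique (@Rhausdorff R) dx).
  rewrite (_ : (fun _ => _) = fun=> 0); first exact: cvg_cst.
  by apply/funext => k; exact: H (inl (l_ k)).
(* [emb Et] reflects convergence, so the restriction of [w] is sequentially continuous. *)
have [g gf] : exists g : seq_fun Zs Zt, forall x, g x = f x.
  apply: (seq_fun_of sZs) => x_ x xx; apply: (emb_inv_cvg (E := Et)).
  rewrite fP (_ : (fun _ => _) = fun k => w (emb Es (x_ k))); last first.
    by apply/funext => k; rewrite -fP.
  by apply: (@seq_fun_seq_continuous _ _ w); exact: (@emb_cvg _ _ _ Es).
(* [w] and the extension of [g] agree on the dense samples of [Fs], hence everywhere. *)
exists g; apply: seq_funP => v.
have [l_ [_ lv]] := @sample_dense _ _ _ Fs [::] v (fun _ _ => ltac:(by [])).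
apply: (cvg_unique hWt (@seq_fun_seq_continuous _ _ (avg_fun (mdirac g)) _ _ lv)).
rewrite (_ : _ \o _ = w \o (fun k => sample Fs ([::] ++ l_ k))).
  exact: (@seq_fun_seq_continuous _ _ w).
apply/funext => k /=; apply/esym; apply: (test_emb_inj (E := Ft) hWt) => j.
rewrite -(@reprojectedE _ w) => [|x]; last by rewrite gf fP.
by apply/eqP; rewrite -subr_eq0 -normr_eq0; apply/eqP; exact: H (inr (j, l_ k)).
Qed.

Lemma arrow_embedding :
  inhabited (@prob_embedding R (seq_fun Zs Zt) (seq_fun Ws Wt)).
Proof.
(* Conditions are enumerated by codes of implications [(p, q)]; a number coding none gets a default
   pair. *)
have /choice[T TP] := fun n =>
  let pq := odflt ([::], 0%N) (unpickle n) in arrow_test pq.1 pq.2.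
have [D [D0 Dc DP]] := arrow_dst.
have [f0 _] := seq_cst_fun Zs (origin Et).
constructor.
apply: (@ProbEmbedding R _ _ avg_fun avg_fun_cvg f0 T _ _ _ D D0 Dc DP).
- by move=> c; have [] := TP c.
- by move=> c; have [] := TP c.
- move=> B f Bf g gB; apply: (arrow_test_sep Bf) => p q Bpq.
  have [_ _] := TP (pickle (p, q)); rewrite pickleK /= => TE.
  have := gB (pickle (p, q)) _; have [n Bn] := Bpq.
  move=> Hk; have : \forall k \near \oo,
      T (pickle (p, q)) (avg_fun (mdirac (g k))) = 0.
    by apply: Hk; exists n => w /Bn Bw; apply/TE.
  by apply: filterS => k /TE.
Qed.

End arrow.

(** * Base types *)

Section metric.
Context {R : realType}.

Lemma metric_cvgP (T : metricType R) (u : nat -> T) (l : T) :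
  u @ \oo --> l <->
  forall e : R, 0 < e -> \forall k \near \oo, mdist l (u k) < e.
Proof. exact: metricType_numDomainType.cvgrPdist_lt. Qed.

Lemma metric_sequential (T : metricType R) : sequential T.
Proof.
move=> A sA; rewrite openE => x Ax; apply: contrapT => nA.
have /choice[y yP] : forall n : nat, exists y, mdist x y < n.+1%:R^-1 /\ ~ A y.
  move=> n; apply: contrapT => H; apply: nA.
  apply/metricType_numDomainType.nbhs_mdistP.
  exists n.+1%:R^-1; first by rewrite /= invr_gt0.
  by move=> y /= xy; apply: contrapT => nAy; apply: H; exists y.
have yx : y @ \oo --> x.
  apply/metric_cvgP => e e0; near=> n.
  apply: lt_trans (yP n).1 _; rewrite -[ltRHS]invrK ltf_pV2 ?posrE ?invr_gt0//.
  rewrite (lt_le_trans (truncnS_gt _))// ler_nat ltnS.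
  by near: n; exact: nbhs_infty_ge.
have [n _ /(_ n (leqnn n))] := sA _ _ yx Ax.
by case: (yP n).
Unshelve. all: by end_near. Qed.

Lemma cauchy_seq_cvg (T : completeMetricType R) (u : nat -> T) :
  (forall e : R, 0 < e -> exists N, forall m n, (N <= m)%N -> (N <= n)%N ->
     mdist (u m) (u n) < e) ->
  exists l : T, u @ \oo --> l.
Proof.
move=> cu; apply/cvg_ex; apply: cauchy_cvg; apply/cauchy_ballP => e e0.
have [N NP] := cu e e0.
exists (u @` [set n | (N <= n)%N], u @` [set n | (N <= n)%N]) => /=.
  by split; exists N => // n /= Nn; exists n.
by move=> [x y] /= [[m /= Nm <-] [n /= Nn <-]]; rewrite ballEmdist; exact: NP.
Qed.

Lemma separable_seq (T : completeMetricType R) : separable T ->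
  exists a : nat -> T, forall x (e : R), 0 < e -> exists i, mdist x (a i) < e.
Proof.
move=> [D /countable_injP[f fi] dD].
exists (fun n => if pselect (exists2 x, D x & f x = n) is left h
  then sval (cid2 h) else point) => x e e0.
have /(_ _ _)[||y [/= xy Dy]] := dD (ball x e)^°; [|exact: open_interior|].
  by exists x; apply: nbhsx_ballx.
exists (f y); case: pselect => [h|[]]; last by exists y.
case: cid2 => z /= Dz fz; rewrite (fi z y) ?inE//.
by move/interior_subset: xy; rewrite ballEmdist.
Qed.

(** As [d] may vanish between distinct indices while saturation concerns metric spaces, [L] keeps
    the indices up to [n] that are least in their class of indices at distance 0, and [K] those
    below [n]. *)
Lemma saturated_step (U : metricType R) (d : nat -> nat -> R) (n : nat)
    (u : nat -> U) :
  finitely_saturated U ->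
  (forall i, d i i = 0) -> (forall i j, d i j = d j i) ->
  (forall i j k, d i k <= d i j + d j k) ->
  (forall i j, (i < n)%N -> (j < n)%N -> mdist (u i) (u j) = d i j) ->
  exists v, forall i, (i < n)%N -> mdist (u i) v = d i n.
Proof.
move=> satU d0 dC dT ud.
have dge0 i j : 0 <= d i j by have := dT i j i; rewrite d0 (dC j); lra.
have dE i j k : d i j = 0 -> d i k = d j k.
  move=> ij; have ji : d j i = 0 by rewrite dC.
  apply/le_anti; have := dT i j k; have := dT j i k.
  by rewrite ij ji !add0r => -> ->.
pose rep (i : 'I_n.+1) := [forall j : 'I_n.+1, (j < i)%N ==> (d j i != 0)].
have repP (i : 'I_n.+1) : exists2 r : 'I_n.+1, (r <= i)%N & rep r /\ d r i = 0.
  have ex : exists j, (j <= i)%N && (d j i == 0) by exists i; rewrite leqnn d0 eqxx.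
  case: (ex_minnP ex) => m /andP[mi /eqP dm] mmin.
  have mn : (m < n.+1)%N by exact: leq_ltn_trans mi (ltn_ord i).
  exists (Ordinal mn) => //; split=> //; apply/forallP => j; apply/implyP => /= jm.
  apply/eqP => dj; have := mmin j; rewrite (dE _ _ i dj) dm eqxx andbT.
  by rewrite (leq_trans (ltnW jm) mi) leqNgt jm => /(_ isT).
pose M := {i : 'I_n.+1 | rep i}.
pose dM (x y : M) := d (val (val x)) (val (val y)).
have dM0 (x y : M) : dM x y = 0 -> x = y.
  rewrite /dM; case: x y => [x rx] [y ry] /= xy; apply/val_inj => /=.
  apply/val_inj; have [xy'|yx|//] := ltngtP x y.
  - by move/forallP/(_ x): ry; rewrite xy' xy eqxx.
  - by move/forallP/(_ y): rx; rewrite yx dC xy eqxx.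
pose m := isMetric.Build R M (fun x => d0 (val (val x))) dM0
  (fun x y => dC (val (val x)) (val (val y)))
  (fun y x z => dT (val (val x)) (val (val y)) (val (val z))).
pose L : metricType R := HB.pack M m.
pose K : set L := [set x | (val (val (x : M)) < n)%N].
have finL : finite_set [set: L] by exact: (@finite_finset M).
have [x y|psi [psid psiK]] :=
    satU L K (fun x => u (val (val (set_val x : M)))) finL.
  have := set_valP x; have := set_valP y; rewrite /K /= => yn xn.
  by rewrite ud.
(* If [n] is at distance 0 from an earlier index, the old point serves; otherwise [n] is a
   representative and [psi] supplies the point. *)
have [j0|nj0] := pselect (exists2 i, (i < n)%N & d i n = 0).
  have [i iltn din] := j0; exists (u i) => j jn; rewrite ud//.
  by rewrite dC (dE _ _ _ din) dC.
have repn : rep ord_max.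
  apply/forallP => j; apply/implyP => /= jn; apply/eqP => dj.
  by apply: nj0; exists j.
exists (psi (exist _ ord_max repn)) => i iltn.
have [r ri [repr dri]] := repP (Ordinal (ltnW iltn : (i < n.+1)%N)).
have rn : (r < n)%N by exact: leq_ltn_trans ri iltn.
have ur : u i = u r.
  by apply: mdist_positivity; rewrite ud// dC.
have rK : (exist _ r repr : L) \in K by rewrite inE.
rewrite ur; have := psiK (exist _ (exist _ r repr : L) rK).
rewrite /set_val /= => <-.
by rewrite psid /mdist/= /dM /= (dE _ _ _ dri).
Qed.

End metric.

(** * Isometric embedding into a saturated complete space *)

Section isometric_embedding.
Context {R : realType}.

Lemma saturated_seq (U : completeMetricType R) (d : nat -> nat -> R) :
  finitely_saturated U ->
  (forall i, d i i = 0) -> (forall i j, d i j = d j i) ->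
  (forall i j k, d i k <= d i j + d j k) ->
  exists u : nat -> U, forall i j, mdist (u i) (u j) = d i j.
Proof.
move=> satU d0 dC dT.
pose iso n (u : nat -> U) := forall i j, (i < n)%N -> (j < n)%N ->
  mdist (u i) (u j) = d i j.
have /choice[next nextP] : forall nu : nat * (nat -> U), exists v,
    iso nu.1 nu.2 -> forall i, (i < nu.1)%N -> mdist (nu.2 i) v = d i nu.1.
  move=> [n u]; have [ni|] := pselect (iso n u); last by exists point.
  by have [v vP] := saturated_step satU d0 dC dT ni; exists v.
(* Stage [n] is isometric on the indices below [n] and later stages keep these values, so the
   diagonal is isometric. *)
pose fix us n : nat -> U :=
  if n is m.+1 then fun i => if (i < m)%N then us m i else next (m, us m)
  else fun=> point.
have usP n : iso n (us n).
  elim: n => [//|n IH] i j; rewrite !ltnS /= => iltn jltn.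
  have nP := nextP (n, us n) IH.
  have [i_n|i_n] := ltnP i n; have [j_n|j_n] := ltnP j n.
  - exact: IH.
  - by rewrite nP//; congr d; apply/eqP; rewrite eqn_leq j_n jltn.
  - by rewrite metric_sym nP// dC; congr d; apply/eqP; rewrite eqn_leq i_n iltn.
  - have -> : i = j.
      by apply/eqP; rewrite eqn_leq (leq_trans iltn j_n) (leq_trans jltn i_n).
    by rewrite mdistxx d0.
have us_stable k n i : (i < n)%N -> us (k + n)%N i = us n i.
  elim: k => [//|k IH] ni; rewrite addSn /= IH// ifT//.
  exact: ltn_addl.
exists (fun n => us n.+1 n) => i j.
rewrite -(us_stable j i.+1 i)// -(us_stable i j.+1 j)//.
have -> : (j + i.+1 = i + j.+1)%N by rewrite !addnS addnC.
by apply: usP; rewrite ?addnS ltnS ?leq_addl ?leq_addr.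
Qed.

(** The dense sequence is embedded term by term; completeness of [U] then sends [x] to the limit of
    the images of terms approximating [x]. [D] is a pseudometric, so [iota] may identify points. *)
Lemma urysohn_universal (U : completeMetricType R) (V : Type) (D : V -> V -> R)
    (t : nat -> V) :
  finitely_saturated U ->
  (forall x, D x x = 0) -> (forall x y, D x y = D y x) ->
  (forall x y z, D x z <= D x y + D y z) ->
  (forall x (e : R), 0 < e -> exists n, D x (t n) < e) ->
  exists iota : V -> U, forall x y, mdist (iota x) (iota y) = D x y.
Proof.
move=> satU D0 DC DT tD.
have [u uP] := @saturated_seq U (fun i j => D (t i) (t j)) satU (fun i => D0 (t i))
  (fun i j => DC (t i) (t j)) (fun i j k => DT (t i) (t j) (t k)).
have /choice[s sP] : forall xk : V * nat, exists n, D xk.1 (t n) < xk.2.+1%:R^-1.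
  by move=> [x k]; apply: tD; rewrite invr_gt0.
have inv_small (e : R) : 0 < e -> exists N, forall n, (N <= n)%N -> n.+1%:R^-1 < e.
  move=> e0; exists (Num.trunc e^-1) => n Nn.
  rewrite -[ltRHS]invrK ltf_pV2 ?posrE ?invr_gt0//.
  by rewrite (lt_le_trans (truncnS_gt _))// ler_nat.
have /choice[iota iotaP] : forall x, exists l : U, (fun k => u (s (x, k))) @ \oo --> l.
  move=> x; apply: cauchy_seq_cvg => e e0.
  have [|N NP] := inv_small (e / 2); first by rewrite divr_gt0.
  exists N => m n /NP Nm /NP Nn; rewrite uP.
  have := DT (t (s (x, m))) x (t (s (x, n))); rewrite (DC _ x).
  have := sP (x, m); have := sP (x, n) => /= hn hm h.
  rewrite (le_lt_trans h)// (splitr e) ltrD//.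
    exact: lt_trans hm Nm.
  exact: lt_trans hn Nn.
exists iota => x y; apply/eqP; rewrite -subr_eq0 -normr_le0.
apply/ler_addgt0Pl => /= e e0.
(* Approximating [x] and [y] by terms of [t], both in [V] and in [U], makes four errors below
   [e / 4]. *)
rewrite addr0; have e4 : 0 < e / 4 by rewrite divr_gt0.
near \oo => k.
have hx : mdist (iota x) (u (s (x, k))) < e / 4.
  by near: k; exact: (proj1 (metric_cvgP _ _) (iotaP x) _ e4).
have hy : mdist (iota y) (u (s (y, k))) < e / 4.
  by near: k; exact: (proj1 (metric_cvgP _ _) (iotaP y) _ e4).
have kx : D x (t (s (x, k))) < e / 4.
  apply: lt_trans (sP (x, k)) _; near: k; have [N NP] := inv_small _ e4.
  by exists N.
have ky : D y (t (s (y, k))) < e / 4.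
  apply: lt_trans (sP (y, k)) _; near: k; have [N NP] := inv_small _ e4.
  by exists N.
have uk := uP (s (x, k)) (s (y, k)).
have := metric_triangle (iota x) (u (s (x, k))) (iota y).
have := metric_triangle (u (s (x, k))) (u (s (y, k))) (iota y).
have := metric_triangle (u (s (x, k))) (iota x) (u (s (y, k))).
have := metric_triangle (iota x) (iota y) (u (s (y, k))).
have := DT x (t (s (x, k))) y; have := DT (t (s (x, k))) (t (s (y, k))) y.
have := DT (t (s (x, k))) x (t (s (y, k))); have := DT x y (t (s (y, k))).
rewrite !(DC (t _) x) !(DC (t _) y) !(metric_sym (u _) (iota _)) uk.
by move=> *; rewrite ler_norml; apply/andP; split; lra.
Unshelve. all: by end_near. Qed.

End isometric_embedding.

(** * The bounded Lipschitz metric on weighted lists *)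

Section base.
Context {R : realType}.
Variables (X U : completeMetricType R).

Definition lipschitz_test (phi : X -> R) : Prop :=
  (forall x, `|phi x| <= 1) /\ forall x y, `|phi x - phi y| <= mdist x y.

(* The bounded Lipschitz (Dudley) metric. *)
Definition mlist_dist (mu nu : seq (R * X)) : R :=
  sup [set `|ev mu phi - ev nu phi| | phi in lipschitz_test].

Lemma lipschitz_test0 : lipschitz_test (fun=> 0).
Proof.
by split=> [x|x y]; rewrite ?subrr normr0 ?mdist_ge0.
Qed.

Lemma mlist_dist_has_sup mu nu :
  has_sup [set `|ev mu phi - ev nu phi| | phi in lipschitz_test].
Proof.
have evle (la : seq (R * X)) phi : lipschitz_test phi ->
    `|ev la phi| <= \sum_(p <- la) `|p.1|.
  move=> [phi1 _]; rewrite (le_trans (ler_norm_sum _ _ _))//.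
  by apply: ler_sum => p _; rewrite normrM ler_piMr.
split.
  exists `|ev mu (fun=> 0) - ev nu (fun=> 0)|; exists (fun=> 0) => //.
  exact: lipschitz_test0.
exists (\sum_(p <- mu) `|p.1| + \sum_(p <- nu) `|p.1|) => _ [phi lphi <-].
by rewrite (le_trans (ler_normB _ _))// lerD// evle.
Qed.

Lemma mlist_dist_ub mu nu phi : lipschitz_test phi ->
  `|ev mu phi - ev nu phi| <= mlist_dist mu nu.
Proof.
by move=> lphi; apply: sup_upper_bound; [exact: mlist_dist_has_sup|exists phi].
Qed.

Lemma mlist_dist_le mu nu c :
  (forall phi, lipschitz_test phi -> `|ev mu phi - ev nu phi| <= c) ->
  mlist_dist mu nu <= c.
Proof.
move=> H; apply: ge_sup => [|_ [phi lphi <-]]; last exact: H.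
by have [] := mlist_dist_has_sup mu nu.
Qed.

Lemma mlist_dist_ge0 mu nu : 0 <= mlist_dist mu nu.
Proof. exact: le_trans (mlist_dist_ub mu nu lipschitz_test0). Qed.

Lemma mlist_distxx mu : mlist_dist mu mu = 0.
Proof.
apply/le_anti; rewrite mlist_dist_ge0 andbT.
by apply: mlist_dist_le => phi _; rewrite subrr normr0.
Qed.

Lemma mlist_distC mu nu : mlist_dist mu nu = mlist_dist nu mu.
Proof.
by apply/le_anti/andP; split; apply: mlist_dist_le => phi lphi;
  rewrite distrC; exact: mlist_dist_ub.
Qed.

Lemma mlist_dist_triangle mu nu la :
  mlist_dist mu la <= mlist_dist mu nu + mlist_dist nu la.
Proof.
apply: mlist_dist_le => phi lphi.
rewrite (le_trans (ler_distD (ev nu phi) _ _))//.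
by rewrite lerD// mlist_dist_ub.
Qed.

Lemma mlist_dist_dirac_le x y : mlist_dist (mdirac x) (mdirac y) <= mdist x y.
Proof. by apply: mlist_dist_le => phi [_ lphi]; rewrite !ev_dirac. Qed.

(** The distance to [x] truncated at 1 is an admissible test function. *)
Lemma mlist_dist_dirac_ge x y :
  clamp (mdist x y) <= mlist_dist (mdirac x) (mdirac y).
Proof.
pose phi z : R := clamp (mdist x z).
have lphi : lipschitz_test phi.
  split=> [z|z z'].
    by have /andP[? ?] := clamp_itv (mdist x z); rewrite ger0_norm.
  apply: le_trans (clamp_lipschitz _ _) _.
  have := metric_triangle x z z'; have := metric_triangle x z' z.
  by rewrite (metric_sym z') ler_norml => *; apply/andP; split; lra.
have := mlist_dist_ub (mdirac x) (mdirac y) lphi.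
rewrite !ev_dirac /phi mdistxx distrC (@clamp_le0 _ 0)// subr0; apply: le_trans.
exact: ler_norm.
Qed.

(** For each [k] choose a test function that nearly attains the supremum; sharing the Lipschitz
    constant 1, these form a probe. *)
Lemma mlist_dist_mcvg (mu_ : nat -> seq (R * X)) mu : mcvg mu_ mu ->
  (fun k => mlist_dist (mu_ k) mu) @ \oo --> (0 : R).
Proof.
move=> mm.
have /choice[phi phiP] : forall k, exists phi, lipschitz_test phi /\
    mlist_dist (mu_ k) mu <= `|ev (mu_ k) phi - ev mu phi| + k.+1%:R^-1.
  move=> k; have k0 : 0 < k.+1%:R^-1 :> R by rewrite invr_gt0.
  have [_ [phi lphi <-] lt] := sup_adherent k0 (mlist_dist_has_sup (mu_ k) mu).
  by exists phi; split=> //; rewrite -lerBlDr; exact: ltW.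
apply: (@cvg0_le _ _ (fun k => `|ev (mu_ k) (phi k) - ev mu (phi k)| + k.+1%:R^-1)).
  by apply: nearW => k; rewrite ger0_norm ?mlist_dist_ge0//; case: (phiP k).
rewrite -[X in _ --> X](addr0 (0 : R)); apply: cvgD; last exact: cvg_harmonic.
apply/norm_cvg0P; apply: mm; split=> [k z|z_ z zz]; first by case: (phiP k) => -[].
apply: (@cvg0_le _ _ (fun k => mdist z (z_ k))).
  by apply: nearW => k; rewrite metric_sym; case: (phiP k) => -[_].
apply/cvgr0Pnorm_lt => e e0; apply: filterS (proj1 (metric_cvgP _ _) zz e e0) => k.
by rewrite ger0_norm ?mdist_ge0.
Qed.

Lemma mlist_dist_cons (p q : R * X) mu nu :
  mlist_dist (p :: mu) (q :: nu) <=
    `|p.1 - q.1| + `|p.1| * mdist p.2 q.2 + mlist_dist mu nu.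
Proof.
apply: mlist_dist_le => phi lphi; have [phi1 phil] := lphi.
rewrite /ev !big_cons -/(ev mu phi) -/(ev nu phi).
rewrite (_ : _ - _ = (p.1 - q.1) * phi q.2 + p.1 * (phi p.2 - phi q.2) +
  (ev mu phi - ev nu phi)); last by ring.
rewrite (le_trans (ler_normD _ _))// lerD ?mlist_dist_ub//.
rewrite (le_trans (ler_normD _ _))// lerD// normrM; first by rewrite ler_piMr.
by rewrite ler_wpM2l.
Qed.

(** Rational weights at points of a dense sequence suffice: an atom costs [e / 4] for its weight and
    [e / 4] for its position, leaving [e / 2] for the rest. *)
Lemma mlist_dist_dense : separable X ->
  exists t : nat -> seq (R * X),
    forall mu e, 0 < e -> exists n, mlist_dist mu (t n) < e.
Proof.
move=> /separable_seq[a aP].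
pose T (l : seq (rat * nat)) : seq (R * X) := [seq (ratr p.1, a p.2) | p <- l].
exists (fun n => T (odflt [::] (unpickle n))) => mu e e0.
suff [l lP] : exists l, mlist_dist mu (T l) < e by exists (pickle l); rewrite pickleK.
elim: mu e e0 => [|p mu IH] e e0; first by exists [::]; rewrite mlist_distxx.
have [|l lP] := IH (e / 2); first by rewrite divr_gt0.
(* Adding 1 permits the division when the weight is 0. *)
have p0 : 0 < `|p.1| + 1 by rewrite ltr_wpDl.
have [|i iP] := aP p.2 (e / 4 / (`|p.1| + 1)); first by rewrite !divr_gt0.
have [|q] := @rat_in_itvoo R (p.1 - e / 4) (p.1 + e / 4); first by lra.
rewrite in_itv /= => /andP[q1 q2].
exists ((q, i) :: l); apply: le_lt_trans (mlist_dist_cons _ _ _ _) _ => /=.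
have h1 : `|p.1 - ratr q| <= e / 4 by rewrite ler_norml; apply/andP; split; lra.
have h2 : `|p.1| * mdist p.2 (a i) <= e / 4.
  apply: (@le_trans _ _ (`|p.1| * (e / 4 / (`|p.1| + 1)))).
    by rewrite ler_wpM2l// ltW.
  by rewrite mulrCA ler_piMr ?divr_ge0 ?ltW// ltr_pdivrMr// mul1r ltrDl.
rewrite -/(T l); lra.
Qed.

End base.

(** * The base case: a separable complete metric space *)

Section base_embedding.
Context {R : realType}.
Variables (X U : completeMetricType R).

Section net.
Variables (iota : seq (R * X) -> U) (a : nat -> X).
Hypothesis iotaE : forall mu nu, mdist (iota mu) (iota nu) = mlist_dist mu nu.
Hypothesis a_dense : forall x (e : R), 0 < e -> exists i, mdist x (a i) < e.

Let emb0 x := iota (mdirac x).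

Let emb0_le x y : mdist (emb0 x) (emb0 y) <= mdist x y.
Proof. by rewrite iotaE mlist_dist_dirac_le. Qed.

Let emb0_ge x y (e : R) : e <= 1 -> mdist (emb0 x) (emb0 y) < e -> mdist x y < e.
Proof.
move=> e1; rewrite iotaE => /(le_lt_trans (mlist_dist_dirac_ge x y)).
by rewrite /clamp gt_max gt_min (le_gtF e1) /= => /andP[].
Qed.

Let emb0_cvg_inv (g : nat -> X) z : (forall e : R, 0 < e ->
    \forall k \near \oo, mdist (emb0 z) (emb0 (g k)) < e) -> g @ \oo --> z.
Proof.
move=> gz; apply/metric_cvgP => e e0.
have m0 : 0 < Num.min 1 e by rewrite lt_min ltr01.
apply: filterS (gz _ m0) => k /emb0_ge; rewrite ge_min lexx => /(_ isT).
by rewrite lt_min => /andP[].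
Qed.

Lemma iota_cvg (mu_ : nat -> seq (R * X)) mu :
  mcvg mu_ mu -> iota \o mu_ @ \oo --> iota mu.
Proof.
move=> /mlist_dist_mcvg mm; apply/metric_cvgP => e e0.
have /cvgr0Pnorm_lt/(_ e e0) := mm; apply: filterS => k /=.
by rewrite ger0_norm ?mlist_dist_ge0// metric_sym iotaE.
Qed.

Lemma mdist_seq_continuous (c : U) : seq_continuous (fun u => mdist u c : R).
Proof.
move=> u_ u uu; apply/cvgrPdist_le => /= e e0.
apply: filterS (proj1 (metric_cvgP _ _) uu e e0) => k.
have := metric_triangle u (u_ k) c; have := metric_triangle (u_ k) u c.
by rewrite (metric_sym (u_ k) u) ler_norml => *; apply/andP; split; lra.
Qed.

Definition ball_test (n : nat) (u : U) : R :=
  let im := odflt (0, 0)%N (unpickle n) in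
  clamp (mdist u (emb0 (a im.1)) - im.2.+1%:R^-1).

Lemma ball_test_eq0 i m u :
  ball_test (pickle (i, m)) u = 0 <-> mdist u (emb0 (a i)) <= m.+1%:R^-1.
Proof.
rewrite /ball_test pickleK /= -subr_le0.
by split; [exact: clamp_eq0|exact: clamp_le0].
Qed.

Lemma ball_test_cvg n : seq_continuous (ball_test n : U -> R).
Proof.
move=> u_ u uu; apply: clamp_cvg; apply: cvgB; last exact: cvg_cst.
exact: mdist_seq_continuous.
Qed.

Lemma inv_natS_lt (e : R) : 0 < e -> exists m, m.+1%:R^-1 < e.
Proof.
move=> e0; exists (Num.trunc e^-1).
by rewrite -[ltRHS]invrK ltf_pV2 ?posrE ?invr_gt0// truncnS_gt.
Qed.

(** A ball of radius [r] about a net point within [r / 2] of [z] contains some [B n]: otherwise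
    points of the [B n] outside it would converge to the image of [z]. So the images of [g k]
    eventually lie in this ball. *)
Lemma ball_test_sep (B : nat -> set U) z :
  (forall y_ : nat -> U, (forall k, B k (y_ k)) -> y_ @ \oo --> emb0 z) ->
  forall g : nat -> X,
  (forall c, (exists n, forall u, B n u -> ball_test c u = 0) ->
     \forall k \near \oo, ball_test c (emb0 (g k)) = 0) ->
  g @ \oo --> z.
Proof.
move=> Bz g gB; apply: emb0_cvg_inv => e e0.
have [m me] : exists m, m.+1%:R^-1 < e / 2 by apply: inv_natS_lt; rewrite divr_gt0.
set r : R := m.+1%:R^-1 in me.
have r2 : 0 < r / 2 by rewrite divr_gt0 ?invr_gt0.
have [i zi] := a_dense z r2.
have ei := le_lt_trans (emb0_le z (a i)) zi.
have : \forall k \near \oo, ball_test (pickle (i, m)) (emb0 (g k)) = 0.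
  apply: gB; apply: contrapT => nB.
  have /choice[y yP] : forall n, exists y, B n y /\ r < mdist y (emb0 (a i)).
    move=> n; apply: contrapT => ny; apply: nB; exists n => u Bu.
    apply/ball_test_eq0; rewrite leNgt; apply/negP => lt.
    by apply: ny; exists u.
  have yz : y @ \oo --> emb0 z by apply: Bz => k; case: (yP k).
  have [k _ /(_ k (leqnn k)) /= yk] := proj1 (metric_cvgP _ _) yz _ r2.
  have [_] := yP k; apply/negP; rewrite -leNgt.
  have := metric_triangle (y k) (emb0 z) (emb0 (a i)).
  by rewrite (metric_sym (y k) (emb0 z)); lra.
apply: filterS => k /ball_test_eq0; rewrite -/r => ki.
have := metric_triangle (emb0 z) (emb0 (a i)) (emb0 (g k)).
by rewrite (metric_sym (emb0 (a i)) (emb0 (g k))); lra.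
Qed.

Definition net_dist (u : U) : R := inf (range (fun i => mdist u (emb0 (a i)))).

Lemma net_dist_has_inf u : has_inf (range (fun i => mdist u (emb0 (a i)) : R)).
Proof.
split; first by exists (mdist u (emb0 (a 0%N))); exists 0%N.
by exists 0 => _ [i _ <-]; exact: mdist_ge0.
Qed.

Lemma net_dist_ge0 u : 0 <= net_dist u.
Proof.
apply: lb_le_inf; first by case: (net_dist_has_inf u).
by move=> _ [i _ <-]; exact: mdist_ge0.
Qed.

Lemma net_dist_le u v : net_dist u <= mdist u v + net_dist v.
Proof.
rewrite -lerBlDl; apply: lb_le_inf; first by case: (net_dist_has_inf v).
move=> _ [i _ <-]; rewrite lerBlDl; apply: le_trans (metric_triangle _ _ _).
by apply: inf_lbound; [case: (net_dist_has_inf u)|exists i].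
Qed.

Lemma net_dist_cvg : seq_continuous (net_dist : U -> R).
Proof.
move=> u_ u uu; apply/cvgrPdist_le => /= e e0.
apply: filterS (proj1 (metric_cvgP _ _) uu e e0) => k ue.
have := net_dist_le u (u_ k); have := net_dist_le (u_ k) u.
by rewrite (metric_sym (u_ k) u) ler_norml => *; apply/andP; split; lra.
Qed.

(** The image is closed: net points whose images approach [u] form a Cauchy sequence in [X], and
    completeness of [X] supplies the preimage. *)
Lemma net_dist_eq0 u : net_dist u = 0 <-> exists x, emb0 x = u.
Proof.
split=> [u0|[x <-]]; last first.
  apply/le_anti; rewrite net_dist_ge0 andbT; apply/ler_addgt0Pl => e e0.
  have [i xi] := a_dense x e0; rewrite addr0.
  apply: le_trans (ltW xi); apply: le_trans (emb0_le _ _).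
  by apply: inf_lbound; [case: (net_dist_has_inf (emb0 x))|exists i].
have /choice[s sP] : forall k : nat, exists i, mdist u (emb0 (a i)) < k.+1%:R^-1.
  move=> k; have k0 : 0 < k.+1%:R^-1 :> R by rewrite invr_gt0.
  have [_ [i _ <-] lt] := inf_adherent k0 (net_dist_has_inf u).
  by exists i; move: lt; rewrite -/(net_dist u) u0 add0r.
have su (e : R) : 0 < e ->
    exists N, forall n, (N <= n)%N -> mdist u (emb0 (a (s n))) < e.
  move=> e0; have [N Ne] := inv_natS_lt e0; exists N => n Nn.
  by rewrite (lt_le_trans (sP n))// (le_trans _ (ltW Ne))// lef_pV2 ?posrE// ler_nat.
have [x sx] : exists x : X, (a \o s) @ \oo --> x.
  apply: cauchy_seq_cvg => e e0.
  (* [emb0_ge] recovers distances only up to 1. *)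
  have m0 : 0 < Num.min 1 e by rewrite lt_min ltr01.
  have [|N NP] := su (Num.min 1 e / 2); first by rewrite divr_gt0.
  exists N => m n /NP Nm /NP Nn.
  have /emb0_ge : mdist (emb0 (a (s m))) (emb0 (a (s n))) < Num.min 1 e.
    apply: le_lt_trans (metric_triangle _ u _) _.
    by rewrite (splitr (Num.min 1 e)) ltrD// metric_sym.
  by rewrite ge_min lexx => /(_ isT); rewrite lt_min => /andP[].
exists x; have ex : emb0 \o (a \o s) @ \oo --> emb0 x.
  apply/metric_cvgP => e e0; apply: filterS (proj1 (metric_cvgP _ _) sx e e0) => k.
  exact: le_lt_trans (emb0_le _ _).
have eu : emb0 \o (a \o s) @ \oo --> u.
  by apply/metric_cvgP => e /su[N NP]; exists N.
by apply: (cvg_unique (@metric_hausdorff _ U)) ex eu.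
Qed.

End net.

Lemma base_embedding : separable X -> finitely_saturated U ->
  inhabited (@prob_embedding R X U).
Proof.
move=> sepX satU; have [a aP] := separable_seq sepX.
have [t tP] := mlist_dist_dense sepX.
have [iota iotaE] := urysohn_universal satU (@mlist_distxx _ X) (@mlist_distC _ X)
  (@mlist_dist_triangle _ X) tP.
constructor; apply: (@ProbEmbedding R X U iota (iota_cvg iotaE) point
  (ball_test iota a) _ (@ball_test_cvg iota a) (ball_test_sep iotaE aP)
  (net_dist iota a) (net_dist_ge0 iota a) (@net_dist_cvg iota a)
  (net_dist_eq0 iotaE aP)).
by move=> c w; rewrite /ball_test; have /andP[] := clamp_itv
  (mdist w (iota (mdirac (a (odflt (0, 0)%N (unpickle c)).1))) -
    (odflt (0, 0)%N (unpickle c)).2.+1%:R^-1).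
Qed.

End base_embedding.

(** * The hierarchy *)

Section homeomorphism.
Context {R : realType} {Z W : topologicalType}.
Variable E : @prob_embedding R Z W.
Hypotheses (sZ : sequential Z) (sW : sequential W) (hZ : hausdorff_space Z).

(** A limit of image points is an image point, as [dst] vanishes there, and [emb] reflects
    convergence; so images of closed sets are closed. This yields continuity of the inverse for the
    subspace topology. *)
Lemma emb_closed_map (O : set Z) : open O -> open (~` (emb E @` (~` O))).
Proof.
move=> oO; apply: sW => w_ w ww nw; apply: contrapT => nev.
have /choice[s sP] : forall N, exists kz : nat * Z,
    [/\ (N <= kz.1)%N, ~ O kz.2 & emb E kz.2 = w_ kz.1].
  move=> N; apply: contrapT => H; apply: nev; exists N => // k /= Nk [z nOz zk].
  by apply: H; exists (k, z).
have sw : (fun N => emb E (s N).2) @ \oo --> w.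
  rewrite (_ : (fun _ => _) = w_ \o (fun N => (s N).1)).
    apply: (cvg_comp _ _ _ ww) => A [M _ MA].
    apply: filterS (nbhs_infty_ge M) => N MN; apply: MA => /=.
    by have [Ns _ _] := sP N; exact: leq_trans MN Ns.
  by apply/funext => N; have [_ _ ->] := sP N.
have [z zw] : exists z, emb E z = w.
  apply/dst_eq0; have dw := @dst_cvg _ _ _ E _ _ sw.
  have d0 : dst E \o (fun N => emb E (s N).2) @ \oo --> (0 : R).
    rewrite (_ : _ \o _ = fun=> 0); first exact: cvg_cst.
    by apply/funext => N; apply/dst_eq0; exists (s N).2.
  by apply: (cvg_unique (@Rhausdorff R)) dw d0.
have sz : (fun N => (s N).2) @ \oo --> z by apply: (emb_inv_cvg (E := E)); rewrite zw.
apply: nw; exists z => // Oz.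
have [N _ /(_ N (leqnn N)) /= ON] := sz O (open_nbhs_nbhs (conj oO Oz)).
by have [] := sP N.
Qed.

Lemma emb_functionally_closed : functionally_closed R (range (emb E)).
Proof.
exists (fun w => clamp (dst E w)); split.
- apply: seq_continuous_continuous => // w_ w ww; apply: clamp_cvg.
  exact: (@dst_cvg _ _ _ E _ _ ww).
- by move=> w; exact: clamp_itv.
- apply/seteqP; split=> [w [z _ zw]|w /= w0] /=.
    by apply: clamp_le0; rewrite (proj2 (@dst_eq0 _ _ _ E w))//; exists z.
  have [|z zw] := proj1 (@dst_eq0 _ _ _ E w); last by exists z.
  by apply/le_anti; rewrite dst_ge0 andbT; exact: clamp_eq0.
Qed.

Lemma emb_homeomorphic : homeomorphic Z (range (emb E)).
Proof.
have memE z : emb E z \in range (emb E) by rewrite inE; exists z.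
pose f z : range (emb E) := exist _ (emb E z) (memE z).
have /choice[g gP] : forall a : range (emb E), exists z, emb E z = set_val a.
  by move=> a; have [z _ za] := set_valP a; exists z.
exists f, g; split.
- apply: (@continuous_comp_initial _ _ _ set_val).
  exact: seq_continuous_continuous (@emb_cvg _ _ _ E).
- apply/continuousP => O oO; exists (~` (emb E @` (~` O))).
    exact: emb_closed_map.
  apply/seteqP; split=> a /=; rewrite -gP.
    by move=> H; apply: contrapT => nO; apply: H; exists (g a).
  by move=> Oga [z nOz] /(emb_inj hZ) zg; apply: nOz; rewrite zg.
- by move=> z; apply: (emb_inj hZ (E := E)); rewrite gP.
- by move=> a; apply/val_inj; exact: gP.
Qed.

End homeomorphism.

(** * Induction on the type *)

Section hierarchy.
Variables (R : realType) (k : nat).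
Implicit Types (X : 'I_k -> completeMetricType R) (s : ty k).

Lemma interp_sequential X s : sequential (interp (fun i => X i : topologicalType) s).
Proof.
by case: s => [i|s t] /=; [exact: metric_sequential|exact: seq_fun_sequential].
Qed.

Lemma interp_hausdorff X s :
  hausdorff_space (interp (fun i => X i : topologicalType) s).
Proof.
elim: s => [i|s _ t IH] /=; first exact: metric_hausdorff.
exact: seq_fun_hausdorff.
Qed.

(** The induction ranges over all families [X], because the arrow step also uses the hypothesis for
    the constant family [U], which provides [Fs] and [Ft]. *)
Lemma interp_embedding (U : completeMetricType R) s X :
  is_urysohn U -> (forall i, separable (X i)) ->
  inhabited (@prob_embedding R (interp (fun i => X i : topologicalType) s)
    (interp (fun=> U : topologicalType) s)).
Proof.
move=> [sepU satU]; elim: s X => [i|s IHs t IHt] X sepX.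
  exact: base_embedding.
have [Es] := IHs X sepX; have [Et] := IHt X sepX.
have [Fs] := IHs (fun=> U) (fun=> sepU); have [Ft] := IHt (fun=> U) (fun=> sepU).
apply: (arrow_embedding Es Et Fs Ft); try exact: interp_sequential.
all: exact: interp_hausdorff.
Qed.

End hierarchy.

(* The set A, used as a type, has the subspace topology. *)
Theorem theorem5p1 (R : realType) (k : nat) (s : ty k)
    (X : 'I_k -> completeMetricType R) (U : completeMetricType R) :
  (forall i, separable (X i)) ->
  is_urysohn U ->
  exists A : set (interp (fun _ : 'I_k => U : topologicalType) s),
    functionally_closed R A /\
    homeomorphic (interp (fun i => X i : topologicalType) s) A.
Proof.
move=> sepX uU; have [E] := interp_embedding s uU sepX.
have sU := @interp_sequential R k (fun=> U) s.
exists (range (emb E)); split; first exact: emb_functionally_closed.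
by apply: emb_homeomorphic => //; [exact: interp_sequential|exact: interp_hausdorff].
Qed.
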